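(* Let $\mu$ be a composition of $n$, $\pi$ a $\mu$-involution, and $\lambda=\lambda_{\mathbf a}$ an admissible one-parameter subgroup of $SL_n$. Then in $\mathcal{X}_n$ the point $Q_\pi$ flows to the torus-fixed point $Q_{\tau(\pi)}$: $$\lim_{t\to0}\lambda(t)\cdot Q_\pi=Q_{\tau(\pi)} .$$
   Context: Let $k$ be an algebraically closed field of characteristic $0$, $n\ge2$, $G=SL_n(k)$, $T$ the diagonal torus. $G$ acts on quadratic forms on $k^n$ by $(g\cdot Q)(v)=Q(g^{-1}v)$. The variety of complete quadrics $\mathcal{X}_n$ is the (De Concini–Procesi) wonderful compactification of the space of nondegenerate quadrics; concretely, it is the closure of $\{([A],[\Lambda^2A],\dots,[\Lambda^{n-1}A]) : A \text{ an invertible symmetric } n\times n \text{ matrix}\}$ in $\prod_{i=1}^{n-1}\mathbb{P}(\mathrm{Hom}(\Lambda^i k^n,\Lambda^i (k^n)^\vee))$. Its points are in bijection with complete quadrics: partial flags $0=V_0\subset V_1\subset\dots\subset V_r=k^n$ together with, for each $j$, a nondegenerate quadratic form $Q_j$ up to scalar on $V_j/V_{j-1}$. (Choosing a splitting $k^n=\bigoplus W_j$ with $W_j\cong V_j/V_{j-1}$ and letting $A_j$ be the symmetric matrix of $Q_j$ extended by $0$ on the other summands, the corresponding point is $\lim_{s\to0}$ of the point given by $A=A_r+sA_{r-1}+\dots+s^{r-1}A_1$; it is independent of the splitting.) A composition of $n$ is a sequence $\mu=(\mu_1,\dots,\mu_r)$ of positive integers with sum $n$. A $\mu$-involution is a permutation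 of $[n]$ in one-line notation cut into consecutive strings $\pi=[\pi_1|\dots|\pi_r]$ with $\pi_j$ of length $\mu_j$, such that each $\pi_j$ is an involution when read as the one-line notation of a permutation of its own alphabet $\mathcal{A}_j$ (the set of its letters, in natural order). The complete quadric $Q_\pi$ is: $V_j$ is spanned by the standard basis vectors $e_a$ with $a\in\mathcal{A}_1\cup\dots\cup\mathcal{A}_j$, and the form on $V_j/V_{j-1}$ is $\sum x_{a}x_{b}+\sum x_{c}^2$, summed over the two-cycles $(a,b)$ and one-cycles $(c)$ of $\pi_j$. A barred permutation is a $\mu$-involution, for $\mu$ with all parts at most $2$, such that every string of length two is of the form $ji$ with $j>i$. The map $\tau$ from degenerate involutions ($\mu$-involutions for some $\mu$) to barred permutations: given $\pi=[\pi_1|\dots|\pi_r]$, order the cycles of each $\pi_j$ (including one-cycles) increasingly by their largest element, insert bars between all the cycles, write a one-cycle $(i)$ as the string $i$ and a two-cycle $(i\,j)$ with $i<j$ as the string $ji$. Example: $\tau((68)|(25)(4)(9)|(13)(7))=[86|4|52|9|31|7]$. A sequence of integers $\mathbf a=(a_1,\dots,a_n)$ is admissible if (a) $\sum a_i=0$; (b) $a_1<a_2<\dots<a_n$; (c) $a_i+a_j<a_k+a_l$ whenever $i,j,k<l$; (d) $2a_i<a_j+a_k$ whenever $i,j<k$. The admissible one-parameter subgroup is $\lambda_{\mathbf a}:\mathbb{G}_m\to SL_n$, $t\mapsto\mathrm{diag}(t^{a_1},\dots,t^{a_n})$. *)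

(* Defs.v *)
From mathcomp Require Import all_boot all_order all_algebra.
From mathcomp Require Import mpoly.
From Stdlib Require Import ClassicalEpsilon.

Set Implicit Arguments.
Unset Strict Implicit.
Unset Printing Implicit Defensive.

Import Order.TTheory GRing.Theory Num.Theory.
Local Open Scope ring_scope.

(* The set [n] is 'I_n, so the letters are 0, ..., n - 1, and
   pi = [pi_1 | ... | pi_r] is the sequence of its strings. *)
Section DegenerateInvolutions.
Variable n : nat.
Implicit Types (w : seq 'I_n) (pi : seq (seq 'I_n)).

Definition is_composition (mu : seq nat) : bool :=
  all (fun m => 0 < m)%N mu && (sumn mu == n).

Definition alphabet w : seq 'I_n := sort (fun i j : 'I_n => (i <= j)%N) w.

(* w read as the one-line notation of a permutation of its alphabet: the i-th
   smallest letter is sent to the i-th letter of w; letters outside w are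
   fixed. *)
Definition string_perm w (a : 'I_n) : 'I_n := nth a w (index a (alphabet w)).

Definition involutive_string w : bool :=
  all (fun a => string_perm w (string_perm w a) == a) w.

Definition mu_involution (mu : seq nat) pi : bool :=
  [&& shape pi == mu, perm_eq (flatten pi) (enum 'I_n)
    & all involutive_string pi].

Definition barred_permutation pi : Prop :=
  exists2 mu : seq nat, is_composition mu &
    [/\ all (fun m => m <= 2)%N mu, mu_involution mu pi
      & forall i j : 'I_n, [:: j; i] \in pi -> (i < j)%N].

(* The cycle with largest element a, written i for (i) and ji for (i j), i < j *)
Definition cycle_string w (a : 'I_n) : seq 'I_n :=
  if string_perm w a == a then [:: a] else [:: a; string_perm w a].

(* Largest elements of the cycles of w, in increasing order *)
Definition cycle_maxima w : seq 'I_n :=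
  [seq a <- alphabet w | (string_perm w a <= a)%N].

Definition tau pi : seq (seq 'I_n) :=
  flatten [seq [seq cycle_string w a | a <- cycle_maxima w] | w <- pi].

Definition admissible (a : 'I_n -> int) : Prop :=
  [/\ \sum_(i < n) a i = 0,
      forall i j : 'I_n, (i < j)%N -> a i < a j,
      forall i j k l : 'I_n, (i < l)%N -> (j < l)%N -> (k < l)%N ->
        a i + a j < a k + a l
    & forall i j k : 'I_n, (i < k)%N -> (j < k)%N -> a i *+ 2 < a j + a k].

End DegenerateInvolutions.

(* tau maps degenerate involutions to barred permutations. *)
Section TauBarred.
Variable n : nat.
Implicit Types (w : seq 'I_n) (pi : seq (seq 'I_n)).

Lemma string_perm_mem w a : a \in w -> string_perm w a \in w.
Proof.
move=> aw; rewrite /string_perm mem_nth //.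
by rewrite -(size_sort (fun i j : 'I_n => (i <= j)%N) w) index_mem mem_sort.
Qed.

Lemma perm_cycle_strings w : uniq w -> involutive_string w ->
  perm_eq (flatten [seq cycle_string w a | a <- cycle_maxima w]) w.
Proof.
move=> uw /allP inv; set s := cycle_maxima w; set f := string_perm w.
have ff a : a \in w -> f (f a) = a by move=> /inv/eqP.
have fw a : a \in w -> f a \in w by exact: string_perm_mem.
have smem a : (a \in s) = (f a <= a)%N && (a \in w).
  by rewrite mem_filter mem_sort.
have us : uniq s by rewrite filter_uniq // sort_uniq.
apply: (@perm_trans _ (s ++ [seq f a | a <- s & f a != a])).
  elim: s {smem us} => //= a s IH; rewrite /cycle_string -/(f a).
  case: eqP => //= _; rewrite ?perm_cons //.
  rewrite perm_sym -cat1s perm_catCA /= perm_cons perm_sym.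
  exact: IH.
apply: uniq_perm => //.
  have ufs : uniq [seq a <- s | f a != a] by exact: filter_uniq.
  rewrite cat_uniq us map_inj_in_uniq ?ufs ?andbT /=.
    apply/hasPn => _ /mapP[a + ->]; rewrite mem_filter !smem => /and3P[na la aw].
    rewrite ff //= fw // andbT -ltnNge ltn_neqAle la andbT.
    exact: na.
  move=> a b; rewrite mem_filter smem => /and3P[_ _ aw].
  rewrite mem_filter smem => /and3P[_ _ bw] e.
  by rewrite -(ff a) // e ff.
move=> a; rewrite mem_cat smem; apply/idP/idP.
  case/orP => [/andP[] //|/mapP[b + ->]].
  by rewrite mem_filter smem => /and3P[_ _ /fw].
move=> aw; rewrite aw andbT; case: leqP => //= lt; apply/mapP; exists (f a).
  by rewrite mem_filter smem (ff _ aw) (fw _ aw) andbT -val_eqE /= neq_ltn lt (ltnW lt).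
by rewrite ff.
Qed.

Lemma tau_strings pi u : u \in tau pi ->
  (exists a : 'I_n, u = [:: a]) \/
  (exists i j : 'I_n, (i < j)%N /\ u = [:: j; i]).
Proof.
case/flatten_mapP => w _ /mapP[a]; rewrite mem_filter => /andP[la _] ->.
rewrite /cycle_string; case: eqP => [_|/eqP na]; first by left; exists a.
right; exists (string_perm w a), a; split=> //.
by rewrite ltn_neqAle la andbT.
Qed.

Lemma tau_barred (mu : seq nat) pi :
  mu_involution mu pi -> barred_permutation (tau pi).
Proof.
move=> /and3P[_ per /allP inv].
have ptau : perm_eq (flatten (tau pi)) (enum 'I_n).
  apply: (perm_trans _ per).
  have: {in pi, forall w, uniq w}.
    have : uniq (flatten pi) by rewrite (perm_uniq per) enum_uniq.
    move=> + w wpi; case/splitPr: wpi => p1 p2.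
    by rewrite flatten_cat /= !cat_uniq => /and3P[_ _ /and3P[]].
  rewrite /tau; elim: pi inv {per} => //= w pi IH inv uw.
  rewrite flatten_cat perm_cat //.
    by apply: perm_cycle_strings; [apply: uw|apply: inv]; rewrite mem_head.
  by apply: IH => v vpi; [apply: inv|apply: uw]; rewrite inE vpi orbT.
exists (shape (tau pi)).
  apply/andP; split; last by rewrite -size_flatten (perm_size ptau) size_enum_ord.
  by apply/allP => _ /mapP[u /tau_strings[[a ->]|[i [j [_ ->]]]] ->].
split.
- by apply/allP => _ /mapP[u /tau_strings[[a ->]|[i [j [_ ->]]]] ->].
- rewrite /mu_involution eqxx ptau /=; apply/allP => u.
  case/tau_strings=> [[a ->]|[i [j [ij ->]]]];
    rewrite /involutive_string /string_perm /alphabet /sort /=.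
    by rewrite !eqxx.
  have ji : (i == j) = false by apply/eqP => e; rewrite e ltnn in ij.
  by do 3?rewrite leqNgt ij /= ?eqxx ?ji ?[j == i]eq_sym ?ji /= ?eqxx.
- by move=> i j /tau_strings[[a]|[i' [j' [ij [-> ->]]]]].
Qed.

End TauBarred.

Section Example.

Let o1 : 'I_9 := @Ordinal 9 0 isT.
Let o2 : 'I_9 := @Ordinal 9 1 isT.
Let o3 : 'I_9 := @Ordinal 9 2 isT.
Let o4 : 'I_9 := @Ordinal 9 3 isT.
Let o5 : 'I_9 := @Ordinal 9 4 isT.
Let o6 : 'I_9 := @Ordinal 9 5 isT.
Let o7 : 'I_9 := @Ordinal 9 6 isT.
Let o8 : 'I_9 := @Ordinal 9 7 isT.
Let o9 : 'I_9 := @Ordinal 9 8 isT.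

(* tau ((68) | (25)(4)(9) | (13)(7)) = [86|4|52|9|31|7] *)
Example tau_example :
  tau [:: [:: o8; o6]; [:: o5; o4; o2; o9]; [:: o3; o1; o7]] =
  [:: [:: o8; o6]; [:: o4]; [:: o5; o2]; [:: o9]; [:: o3; o1]; [:: o7]].
Proof. by []. Qed.

End Example.

(* The i-subsets of [n], which index the standard basis of Lambda^i k^n *)
Notation isubset n i := {I : {set 'I_n} | #|I| == i}.

Definition extdim (n i : nat) : nat := #|{: isubset n i}|.

(* The j-th smallest element of I *)
Definition isubset_nth n i (I : isubset n i) (j : 'I_i) : 'I_n :=
  enum_val (cast_ord (esym (eqP (valP I))) j).

(* The matrix of Lambda^i A in the standard bases (the matrix of i x i minors) *)
Definition extmx (R : comNzRingType) n i (A : 'M[R]_n) : 'M[R]_(extdim n i) :=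
  \matrix_(p, q) \det (mxsub (isubset_nth (enum_val p))
                             (isubset_nth (enum_val q)) A).

Section CompleteQuadrics.
Variables (k : fieldType) (n : nat).

(* Hom(Lambda^(i+1) k^n, Lambda^(i+1) (k^n)^v), for 0 <= i < n - 1 *)
Notation homspace i := 'M[k]_(extdim n (nat_of_ord i).+1).

(* A point of a projective space P(V) is a line of V, so a point of the product
   is a family of lines. *)
Definition lines : Type := forall i : 'I_n.-1, {vspace homspace i}.

Definition is_point (x : lines) : Prop := forall i, \dim (x i) = 1%N.

(* The point ([A], [Lambda^2 A], ..., [Lambda^(n-1) A]), for A invertible *)
Definition quadric_lines (A : 'M[k]_n) : lines :=
  fun i => <[extmx (nat_of_ord i).+1 A]>%VS.

Definition symmetric (A : 'M[k]_n) : Prop := A^T = A.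

Definition nondegenerate_quadric (x : lines) : Prop :=
  exists A : 'M[k]_n, [/\ A \in unitmx, symmetric A
                        & forall i, x i = quadric_lines A i].

(* Homogeneous coordinates on the product: one variable for each matrix entry
   of each factor. *)
Notation coord_index :=
  {i : 'I_n.-1 & ('I_(extdim n (nat_of_ord i).+1)
                  * 'I_(extdim n (nat_of_ord i).+1))%type}.

Definition coords (v : forall i : 'I_n.-1, homspace i)
    (c : 'I_#|{: coord_index}|) : k :=
  let: existT i pq := (enum_val c : coord_index) in v i pq.1 pq.2.

(* Homogeneous of degree d i in the coordinates of the i-th factor *)
Definition multihomogeneous (d : 'I_n.-1 -> nat)
    (F : {mpoly k[#|{: coord_index}|]}) : Prop :=
  forall m, m \in msupp F -> forall i : 'I_n.-1,
    (\sum_(c < #|{: coord_index}| | tag (enum_val c : coord_index) == i) m c)%N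
      = d i.

Definition vanishes_at (F : {mpoly k[#|{: coord_index}|]}) (x : lines) : Prop :=
  forall v : forall i : 'I_n.-1, homspace i,
    (forall i, x i = <[v i]>%VS) -> F.@[coords v] = 0.

Definition zariski_closure (S : lines -> Prop) (x : lines) : Prop :=
  is_point x /\
  forall d F, multihomogeneous d F ->
    (forall y, S y -> vanishes_at F y) -> vanishes_at F x.

(* The variety X_n, as a set of points *)
Definition complete_quadrics : lines -> Prop :=
  zariski_closure nondegenerate_quadric.

(* The action of GL_n (hence SL_n) induced by (g . Q)(v) = Q(g^-1 v), that is by
   A |-> g^-T A g^-1 on symmetric matrices. *)
Definition act (g : 'M[k]_n) (x : lines) : lines :=
  fun i => let h := extmx (nat_of_ord i).+1 (invmx g) in
           (linfun (mulmxr h \o mulmx h^T) @: x i)%VS.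

Definition torus_fixed (x : lines) : Prop :=
  forall d : 'rV[k]_n, \det (diag_mx d) = 1 ->
    forall i, act (diag_mx d) x i = x i.

(* The one-parameter subgroup t |-> diag(t^a_1, ..., t^a_n), for t != 0 *)
Definition one_param (a : 'I_n -> int) (t : k) : 'M[k]_n :=
  diag_mx (\row_i t ^ a i).

(* Morphisms from the affine line to X_n. As Pic(A^1) is trivial, a morphism
   from A^1 to a projective space P(V) is given by a vector of polynomials
   without common zero. *)
Definition A1_morphism (psi : k -> lines) : Prop :=
  (exists g : forall i : 'I_n.-1, 'M[{poly k}]_(extdim n (nat_of_ord i).+1),
     forall t i, let gt := map_mx (horner_eval t) (g i) in
       gt != 0 /\ psi t i = <[gt]>%VS)
  /\ (forall t, complete_quadrics (psi t)).

(* lim_(t -> 0) phi(t) = x in X_n: phi, seen as a map on A^1 minus the origin,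
   extends to a morphism A^1 -> X_n with value x at 0. Only the values of phi
   outside 0 matter. *)
Definition limit_at0 (phi : k -> lines) (x : lines) : Prop :=
  exists psi : k -> lines,
    [/\ A1_morphism psi,
        forall t, t != 0 -> forall i, psi t i = phi t i
      & forall i, psi 0 i = x i].

(* The flag is V_0, ..., V_r, with V_j = cq_flag j and r = cq_len, and
   cq_form j represents (up to scalar) the form Q_(j+1) on V_(j+1) / V_j, as a
   function on V_(j+1); other values of cq_flag and cq_form are irrelevant. *)
Record cquadric := CQuadric {
  cq_len : nat;
  cq_flag : nat -> {vspace 'cV[k]_n};
  cq_form : nat -> 'cV[k]_n -> k
}.

Definition qform (A : 'M[k]_n) (v : 'cV[k]_n) : k := (v^T *m A *m v) 0 0.

(* q is a nondegenerate quadratic form on V / U (in characteristic not 2) *)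
Definition nondegenerate_form (U V : {vspace 'cV[k]_n}) (q : 'cV[k]_n -> k) :
    Prop :=
  [/\ exists2 A, symmetric A & {in V, forall v, q v = qform A v},
      {in U & V, forall u v, q (u + v) = q v}
    & {in V, forall v,
         {in V, forall w, q (v + w) - q v - q w = 0} -> v \in U}].

Definition is_complete_quadric (Q : cquadric) : Prop :=
  [/\ cq_flag Q 0 = 0%VS,
      cq_flag Q (cq_len Q) = fullv,
      forall j, (j < cq_len Q)%N ->
        (cq_flag Q j <= cq_flag Q j.+1)%VS && (cq_flag Q j != cq_flag Q j.+1)
    & forall j, (j < cq_len Q)%N ->
        nondegenerate_form (cq_flag Q j) (cq_flag Q j.+1) (cq_form Q j)].

(* W splits the flag (W j is the summand isomorphic to V_(j+1) / V_j), and A j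
   is the symmetric matrix of Q_(j+1) carried to W j and extended by 0 on the
   other summands. *)
Definition cq_splitting (Q : cquadric) (W : nat -> {vspace 'cV[k]_n})
    (A : nat -> 'M[k]_n) : Prop :=
  forall j, (j < cq_len Q)%N ->
    [/\ (cq_flag Q j + W j = cq_flag Q j.+1)%VS /\
        (cq_flag Q j :&: W j = 0)%VS,
        symmetric (A j),
        {in W j, forall v, qform (A j) v = cq_form Q j v}
      & forall i, (i < cq_len Q)%N -> i != j -> {in W i, forall v, A j *m v = 0}].

(* A_r + s A_(r-1) + ... + s^(r-1) A_1 *)
Definition cq_family (Q : cquadric) (A : nat -> 'M[k]_n) (s : k) : 'M[k]_n :=
  \sum_(j < cq_len Q) s ^+ (cq_len Q - j.+1) *: A j.

Definition represents (Q : cquadric) (x : lines) : Prop :=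
  is_complete_quadric Q /\
  exists W A, cq_splitting Q W A /\
    limit_at0 (fun s => quadric_lines (cq_family Q A s)) x.

(* The point of X_n corresponding to Q: well defined because the limit
   in [represents] exists and does not depend on the splitting. *)
Definition cq_point (Q : cquadric) : lines :=
  epsilon (inhabits (fun _ => 0%VS)) (represents Q).

Definition cq_of (pi : seq (seq 'I_n)) : cquadric :=
  {| cq_len := size pi;
     cq_flag := fun j =>
       <<[seq (delta_mx a ord0 : 'cV[k]_n) | a <- flatten (take j pi)]>>%VS;
     cq_form := fun j v =>
       let w := nth [::] pi j in
       \sum_(a <- w | (a < string_perm w a)%N) v a 0 * v (string_perm w a) 0
       + \sum_(c <- w | string_perm w c == c) v c 0 ^+ 2 |}.

End CompleteQuadrics.

(* Main.v *)
(* Both points have explicit coordinates. Let M be the monomial matrix of the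
   involution underlying pi, and weight a letter by the number of strings that
   follow its own. Along the degenerating family of any splitting, the minor (I, J) has
   order at least the weights of I and of J, and its leading coefficient comes
   from M alone; hence the point of pi has coordinates det M_(I, J) for I and J
   of minimal weight (the "top" sets), and 0 elsewhere. This uses no
   Cauchy-Binet formula: entry (x, y) of the family has order at least the
   larger of the weights of x and y, and this passes to Leibniz products.

   The one-parameter subgroup multiplies the coordinate (I, J) by
   t ^ - (a(I) + a(J)). As J is the image of I under the involution, the limit
   keeps the top sets I that maximize the sum of a over the cycles met by I.
   Admissibility says that these sums are ordered as the largest elements of
   the cycles, so the remaining sets are the top sets of tau pi, while M is the
   same for tau pi and for pi. *)
From mathcomp Require Import all_boot all_order all_algebra zify ring.
From mathcomp Require Import perm mpoly.
From Stdlib Require Import ClassicalEpsilon.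
Require Import Defs.

Set Implicit Arguments.
Unset Strict Implicit.
Unset Printing Implicit Defensive.

Import Order.TTheory GRing.Theory Num.Theory.
Local Open Scope ring_scope.

(** * Limits of polynomial families in the Zariski closure *)

(** The polynomial ['X * p + 1] takes the value 1 everywhere, so over an algebraically closed field
    it is constant. *)
Lemma poly_zero_off0 (k : closedFieldType) (p : {poly k}) :
  (forall t, t != 0 -> p.[t] = 0) -> p = 0.
Proof.
move=> p0; set q := 'X * p + 1.
have q1 t : q.[t] = 1.
  rewrite /q !hornerE; have [->|/p0->] := eqVneq t 0; by rewrite ?mul0r ?mulr0 add0r.
have : size q == 1%N.
  apply/negPn/negP => /closed_rootP[x]; rewrite /root q1 => /eqP.
  by apply/eqP; exact: oner_neq0.
rewrite /q mulrC size_MXaddC oner_eq0 andbF eqSS size_poly_eq0.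
by move/eqP.
Qed.

Section Closure.
Variables (k : closedFieldType) (n : nat).
Notation polymats := (forall i : 'I_n.-1, 'M[{poly k}]_(extdim n (nat_of_ord i).+1)).
Notation coord_index :=
  {i : 'I_n.-1 & ('I_(extdim n (nat_of_ord i).+1)
                  * 'I_(extdim n (nat_of_ord i).+1))%type}.
Notation vals g t := (fun i : 'I_n.-1 => map_mx (horner_eval t) (g i)).

Lemma vline_rep (V : vectType k) (u v : V) :
  u != 0 -> <[u]>%VS = <[v]>%VS -> exists2 c, c != 0 & u = c *: v.
Proof.
move=> u0 e; have /vlineP[c uE]: u \in <[v]>%VS by rewrite -e memv_line.
by exists c => //; apply: contraNneq u0 => c0; rewrite uE c0 scale0r.
Qed.

Lemma vline_scale (V : vectType k) (c : k) (v : V) :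
  c != 0 -> <[c *: v]>%VS = <[v]>%VS.
Proof.
move=> c0; apply/eqP; rewrite eqEsubv -!memvE memvZ ?memv_line //=.
by apply/vlineP; exists c^-1; rewrite scalerA mulVf ?scale1r.
Qed.

Lemma zariski_closure_ext S (x y : lines k n) :
  (forall i, x i = y i) -> zariski_closure S x -> zariski_closure S y.
Proof.
move=> e [px cx]; split=> [i|d F hF vF v yv]; first by rewrite -e.
by apply: (cx d F hF vF) => i; rewrite e.
Qed.

Lemma subset_closure S (x : lines k n) : is_point x -> S x -> zariski_closure S x.
Proof. by move=> px Sx; split=> // d F _ /(_ x Sx). Qed.

(** The scalars [c i] account for the choice of a representative in each projective factor. *)
Lemma meval_coords_poly
    (F : {mpoly k[#|{: coord_index}|]})
    (c : 'I_n.-1 -> k) (g : polymats) :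
  exists p : {poly k}, forall t,
    F.@[coords (fun i => c i *: map_mx (horner_eval t) (g i))] = p.[t].
Proof.
pose e (j : 'I_#|{: coord_index}|) : {poly k} :=
  let: existT i pq := (enum_val j : coord_index) in c i *: g i pq.1 pq.2.
exists (\sum_(m <- msupp F) F@_m *: \prod_j e j ^+ m j) => t.
rewrite mevalE horner_sum; apply: eq_bigr => m _.
rewrite hornerZ horner_prod; congr (_ * _); apply: eq_bigr => j _.
rewrite horner_exp; congr (_ ^+ _); rewrite /coords /e.
by case: (enum_val j) => i pq; rewrite !mxE hornerZ.
Qed.

(** Any representative of the limit is [c i] times [g i] at 0. With the same [c], an equation [F] of
    [S] becomes a polynomial in [t] that vanishes for [t != 0], hence also at 0. *)
Lemma zariski_closure_limit S (g : polymats) (x : k -> lines k n) :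
  (forall t, t != 0 -> zariski_closure S (x t)) ->
  (forall t i, t != 0 -> x t i = <[vals g t i]>%VS) ->
  (forall i, vals g 0 i != 0) ->
  zariski_closure S (fun i => <[vals g 0 i]>%VS).
Proof.
move=> Sx xE g0; split=> [i|d F hF vF v ev]; first by rewrite dim_vline g0.
have cP i : exists c, (c != 0) && (v i == c *: vals g 0 i).
  have v0 : v i != 0.
    apply: contraNneq (g0 i) => vi0; have := ev i; rewrite vi0 => /esym e.
    have: vals g 0 i \in <[0 : 'M[k]_(extdim n i.+1)]>%VS by rewrite e memv_line.
    by rewrite memv0.
  by have [c c0 ->] := vline_rep v0 (esym (ev i)); exists c; rewrite c0 /=.
have [c cE] := fin_all_exists cP.
have [p pE] := meval_coords_poly F c g.
have p0 : p = 0.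
  apply: poly_zero_off0 => t t0; rewrite -pE.
  have [_ /(_ d F hF vF)] := Sx t t0; apply=> i.
  by have /andP[c0 _] := cE i; rewrite xE // vline_scale.
have := pE 0; rewrite p0 horner0 => <-.
by apply: meval_eq => j; rewrite /coords; case: (enum_val j) => i pq;
  have /andP[_ /eqP->] := cE i.
Qed.

(** Separatedness of projective space: two polynomial lifts of the same lines have 2 x 2 cross
    products vanishing for [t != 0], hence at 0, where both lifts are nonzero and so
    proportional. *)
Lemma limit_unique (g : forall t : k, lines k n) (h : polymats) x :
  limit_at0 g x -> (forall t i, t != 0 -> g t i = <[vals h t i]>%VS) ->
  (forall i, vals h 0 i != 0) -> forall i, x i = <[vals h 0 i]>%VS.
Proof.
move=> [psi [[[f fE] _] psig psi0]] gE h0 i; rewrite -psi0.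
have [f0 ->] := fE 0 i.
have cross p q p' q' : (f i p q).[0] * (h i p' q').[0] = (f i p' q').[0] * (h i p q).[0].
  suff /(congr1 (horner^~ 0)) : f i p q * h i p' q' - f i p' q' * h i p q = 0.
    by rewrite /= !hornerE => /eqP; rewrite subr_eq0 => /eqP.
  apply: poly_zero_off0 => t t0; have [ft0 e] := fE t i.
  move: e; rewrite psig // gE // => /esym e; have [c c0 fh] := vline_rep ft0 e.
  have fhE p1 q1 : (f i p1 q1).[t] = c * (h i p1 q1).[t].
    by move/matrixP/(_ p1 q1): fh; rewrite !mxE.
  by rewrite !hornerE !fhE -!mulrA [X in c * X]mulrC subrr.
have /matrix0Pn[p [q pq0]] := h0 i; rewrite mxE /horner_eval in pq0.
have /matrix0Pn[p' [q' pq0']] := f0; rewrite mxE /horner_eval in pq0'.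
have fpq0 : (f i p q).[0] != 0.
  apply: contraNneq pq0' => fpq; have := cross p q p' q'.
  by rewrite fpq mul0r => /esym/eqP; rewrite mulf_eq0 (negPf pq0) orbF.
rewrite -(@vline_scale _ ((f i p q).[0] / (h i p q).[0]) (vals h 0 i)); last first.
  by rewrite mulf_neq0 ?invr_eq0.
congr <[_]>%VS; apply/matrixP => p1 q1; rewrite !mxE /horner_eval.
by apply: (mulIf pq0); rewrite mulrAC divfK // cross.
Qed.

(** Dividing the coordinates by [t ^ m i] does not move the lines and makes all relevant exponents
    nonnegative; at 0 only the entries of exponent exactly [m i] survive. *)
Lemma monomial_limit (phi : k -> lines k n)
    (Z Z0 : forall i : 'I_n.-1, 'M[k]_(extdim n i.+1))
    (e : forall i : 'I_n.-1, 'I_(extdim n i.+1) -> 'I_(extdim n i.+1) -> int)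
    (m : 'I_n.-1 -> int) :
  (forall t, t != 0 -> complete_quadrics (phi t)) ->
  (forall t i, t != 0 ->
     phi t i = <[\matrix_(p, q) (t ^ e i p q * Z i p q)]>%VS) ->
  (forall i p q, Z i p q != 0 -> m i <= e i p q) ->
  (forall i p q, Z0 i p q = if e i p q == m i then Z i p q else 0) ->
  (forall i, Z0 i != 0) ->
  limit_at0 phi (fun i => <[Z0 i]>%VS).
Proof.
move=> cphi phiE me Z0E Z0n.
pose g i : 'M[{poly k}]_(extdim n (nat_of_ord i).+1) :=
  (* The absolute value changes the exponent only where [Z i p q = 0], where the exponent is
     irrelevant. *)
  \matrix_(p, q) (Z i p q *: 'X^`|e i p q - m i|).
have g0 i : vals g 0 i = Z0 i.
  apply/matrixP => p q; rewrite !mxE /horner_eval hornerZ hornerXn Z0E.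
  rewrite expr0n absz_eq0 subr_eq0.
  by case: (_ == _); rewrite ?mulr1 ?mulr0.
have gt t i : t != 0 -> phi t i = <[vals g t i]>%VS.
  move=> t0; rewrite phiE // -(@vline_scale _ (t ^ (- m i))) ?expfz_neq0 //.
  congr <[_]>%VS; apply/matrixP => p q; rewrite !mxE /horner_eval hornerZ hornerXn.
  rewrite mulrA -expfzDr // mulrC addrC.
  have [->|/me le] := eqVneq (Z i p q) 0; first by rewrite !mul0r.
  by rewrite [_ ^+ _]exprnP gez0_abs // addrC subr_ge0.
exists (fun t i => <[vals g t i]>%VS); split=> [|t t0 i|i]; last first.
- by rewrite -g0.
- by rewrite gt.
split.
  exists g => t i; split=> //; have /matrix0Pn[p [q]] := Z0n i.
  rewrite Z0E; case: ifP => [/eqP epq Zpq|_ /eqP //].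
  apply/matrix0Pn; exists p, q.
  by rewrite !mxE /horner_eval hornerZ hornerXn epq subrr expr0 mulr1.
move=> t; have [->|t0] := eqVneq t 0.
  apply: (zariski_closure_limit cphi gt) => i; by rewrite g0.
by apply: zariski_closure_ext (cphi t t0) => i; rewrite gt.
Qed.

Lemma limit_at0_ext (phi psi : k -> lines k n) (x y : lines k n) :
  (forall t i, t != 0 -> phi t i = psi t i) -> (forall i, x i = y i) ->
  limit_at0 phi x -> limit_at0 psi y.
Proof.
move=> e exy [f [f1 f2 f3]]; exists f; split=> // [t t0 i|i].
  by rewrite f2 // e.
by rewrite f3.
Qed.

End Closure.

(** * Minors of monomial matrices *)

Section Minors.
Variables (n i : nat).
Implicit Types I J : isubset n i.

Lemma isubset_nth_mem I p : isubset_nth I p \in val I.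
Proof. exact: enum_valP. Qed.

Lemma isubset_nth_inj I : injective (isubset_nth I).
Proof. by move=> p q /enum_val_inj/cast_ord_inj. Qed.

Lemma big_isubset (R : Type) (idx : R) (op : Monoid.com_law idx) I (F : 'I_n -> R) :
  \big[op/idx]_(p < i) F (isubset_nth I p) = \big[op/idx]_(x in val I) F x.
Proof.
rewrite big_enum_val (reindex (cast_ord (esym (eqP (valP I))))) //=.
exact/onW_bij/(Bijective (cast_ordK _) (cast_ordKV _)).
Qed.

Lemma card_isubset (p : 'I_(extdim n i)) : #|val (enum_val p)| = i.
Proof. exact/eqP/(valP (enum_val p)). Qed.

Lemma mem_isubset_nth I x : x \in val I -> exists p, x = isubset_nth I p.
Proof.
move=> xI; exists (cast_ord (eqP (valP I)) (enum_rank_in xI x)).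
by rewrite /isubset_nth cast_ordK enum_rankK_in.
Qed.

Variable R : comNzRingType.

Lemma det_minor_scale (u v : 'I_n -> R) (A : 'M_n) I J :
  \det (mxsub (isubset_nth I) (isubset_nth J) (\matrix_(x, y) (u x * A x y * v y))) =
  \prod_(x in val I) u x * \det (mxsub (isubset_nth I) (isubset_nth J) A) *
  \prod_(y in val J) v y.
Proof.
have -> : mxsub (isubset_nth I) (isubset_nth J) (\matrix_(x, y) (u x * A x y * v y)) =
    diag_mx (\row_p u (isubset_nth I p)) *m
    mxsub (isubset_nth I) (isubset_nth J) A *m
    diag_mx (\row_p v (isubset_nth J p)).
  by apply/matrixP => p q; rewrite mul_diag_mx mul_mx_diag !mxE.
rewrite !det_mulmx !det_diag -!big_isubset.
by congr (_ * _ * _); apply: eq_bigr => p _; rewrite mxE.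
Qed.

Definition mono (s : 'I_n -> 'I_n) (d : 'I_n -> R) : 'M[R]_n :=
  \matrix_(x, y) (if y == s x then d x else 0).

(** If no permutation of the positions realizes [s] from [I] to [J], every Leibniz term has a zero
    factor. *)
Lemma minor_mono_perm s d I J :
  \det (mxsub (isubset_nth I) (isubset_nth J) (mono s d)) != 0 ->
  exists t : 'S_i, forall p, isubset_nth J (t p) = s (isubset_nth I p).
Proof.
move=> nz; have [t /forallP tP|no] :=
    pickP (fun t : 'S_i => [forall p, isubset_nth J (t p) == s (isubset_nth I p)]).
  by exists t => p; apply/eqP.
case/eqP: nz; apply: big1 => t _; have /negbT := no t.
rewrite negb_forall => /existsP[p /negPf np].
by rewrite (bigD1 p) //= !mxE np mul0r mulr0.
Qed.

Lemma big_minor_mono (T : Type) (idx : T) (op : Monoid.com_law idx) s d I J F :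
  \det (mxsub (isubset_nth I) (isubset_nth J) (mono s d)) != 0 ->
  \big[op/idx]_(y in val J) F y = \big[op/idx]_(x in val I) F (s x).
Proof.
case/minor_mono_perm => t tP; rewrite -!big_isubset (reindex_perm t) /=.
by apply: eq_bigr => p _; rewrite tP.
Qed.

Lemma minor_mono_mem s d I J x :
  \det (mxsub (isubset_nth I) (isubset_nth J) (mono s d)) != 0 ->
  x \in val I -> s x \in val J.
Proof.
case/minor_mono_perm => t tP /mem_isubset_nth[p ->].
by rewrite -tP isubset_nth_mem.
Qed.

Lemma mono_sym s d : involutive s -> (forall x, d (s x) = d x) ->
  (mono s d)^T = mono s d.
Proof.
move=> sK sd; apply/matrixP => x y; rewrite !mxE.
have [->|ne] := eqVneq y (s x); first by rewrite sK eqxx sd.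
by case: eqP => // e; case/eqP: ne; rewrite e sK.
Qed.

Lemma mono_mul s c d : involutive s ->
  mono s c *m mono s d = diag_mx (\row_x (c x * d (s x))).
Proof.
move=> sK; apply/matrixP => x y; rewrite !mxE (bigD1 (s x)) //= !mxE eqxx sK.
rewrite big1 ?addr0 => [|z /negPf nz]; last by rewrite mxE nz mul0r.
by rewrite [x == y]eq_sym; case: eqP => _; rewrite ?mulr1n ?mulr0.
Qed.

End Minors.

(** The [(J, I)] submatrix of the inverse monomial matrix is an inverse of this submatrix, so no
    sign has to be computed. *)
Lemma minor_mono_neq0 (k : fieldType) n i s (d : 'I_n -> k) (I J : isubset n i) :
  involutive s -> (forall x, d x != 0) -> (forall x, x \in val I -> s x \in val J) ->
  \det (mxsub (isubset_nth I) (isubset_nth J) (mono s d)) != 0.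
Proof.
move=> sK d0 sIJ.
have : mxsub (isubset_nth I) (isubset_nth J) (mono s d) *m
       mxsub (isubset_nth J) (isubset_nth I) (mono s (fun x => (d (s x))^-1)) = 1%:M.
  apply/matrixP => p q; rewrite !mxE.
  under eq_bigr do rewrite !mxE.
  rewrite (big_isubset _ _ (fun y => (if y == s (isubset_nth I p) then d (isubset_nth I p) else 0) *
    (if isubset_nth I q == s y then (d (s y))^-1 else 0))).
  rewrite (bigD1 (s (isubset_nth I p))) ?sIJ ?isubset_nth_mem //= eqxx sK.
  rewrite big1 ?addr0 => [|y /andP[_ /negPf->]]; last by rewrite mul0r.
  rewrite (inj_eq (@isubset_nth_inj _ _ I)) eq_sym.
  by case: eqP; rewrite ?mulr0 // divff.
move/(congr1 determinant); rewrite det_mulmx det1 => e.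
by apply: contra_eq_neq e => ->; rewrite mul0r eq_sym oner_neq0.
Qed.

Lemma mono_unit (k : fieldType) n s (d : 'I_n -> k) :
  involutive s -> (forall x, d x != 0) -> mono s d \in unitmx.
Proof.
move=> sK d0; apply: (proj1 (mulmx1_unit (B := mono s (fun x => (d (s x))^-1)) _)).
rewrite mono_mul //; apply/matrixP => x y; rewrite !mxE sK divff //.
Qed.

(** * Strings and top subsets *)

Section Blocks.
Variable n : nat.
Implicit Types (pi : seq (seq 'I_n)) (x y : 'I_n).

Definition blk pi x : nat := find (fun w => x \in w) pi.

Definition pi_perm pi x : 'I_n := string_perm (nth [::] pi (blk pi x)) x.

(* The sets that minimize the weight [- \sum_(x in I) blk pi x] among the sets
   of the same cardinality *)
Definition topset pi (I : {set 'I_n}) : bool :=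
  [forall x in I, forall y, (y \notin I) ==> (blk pi y <= blk pi x)%N].

Lemma topsetP pi (I : {set 'I_n}) :
  reflect {in I, forall x y, y \notin I -> (blk pi y <= blk pi x)%N} (topset pi I).
Proof.
apply: (iffP forall_inP) => [tI x xI y yI|tI x xI].
  by have /forallP/(_ y) := tI x xI; rewrite yI.
by apply/forallP => y; apply/implyP; apply: tI.
Qed.

Lemma flatten_take_blk pi x j :
  perm_eq (flatten pi) (enum 'I_n) ->
  (x \in flatten (take j pi)) = (blk pi x < j)%N.
Proof.
move=> pe; have xpi : has (fun w => x \in w) pi.
  by have /flattenP[w wpi xw] : x \in flatten pi; [rewrite (perm_mem pe) mem_enum|
    apply/hasP; exists w].
rewrite /blk -(has_take j xpi).
by apply/flattenP/hasP => -[w wp xw]; exists w.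
Qed.

Lemma blk_lt pi x : perm_eq (flatten pi) (enum 'I_n) -> (blk pi x < size pi)%N.
Proof.
by move=> pe; rewrite -flatten_take_blk // take_size (perm_mem pe) mem_enum.
Qed.

Lemma mem_blk pi x : perm_eq (flatten pi) (enum 'I_n) ->
  x \in nth [::] pi (blk pi x).
Proof.
move=> pe; apply: (@nth_find _ [::] (fun w => x \in w)).
by rewrite has_find blk_lt.
Qed.

Lemma nth_blk pi x j : perm_eq (flatten pi) (enum 'I_n) ->
  (x \in nth [::] pi j) = (blk pi x == j).
Proof.
move=> pe; apply/idP/eqP => [xj|<-]; last exact: mem_blk.
have js : (j < size pi)%N.
  by rewrite ltnNge; apply/negP => le; rewrite nth_default in xj.
apply/eqP; rewrite eqn_leq -ltnS -flatten_take_blk // (take_nth [::]) //.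
rewrite flatten_rcons mem_cat xj orbT /= leqNgt; apply/negP.
rewrite -flatten_take_blk // => xt.
have : uniq (flatten pi) by rewrite (perm_uniq pe) enum_uniq.
rewrite -(cat_take_drop j pi) flatten_cat cat_uniq => /and3P[_ /hasPn no _].
by move: (no x); rewrite (drop_nth [::]) //= mem_cat xj xt => /(_ isT).
Qed.

Lemma mem_pi pi x w : perm_eq (flatten pi) (enum 'I_n) -> w \in pi -> x \in w ->
  w = nth [::] pi (blk pi x).
Proof.
by move=> pe /(nthP [::])[j js <-]; rewrite nth_blk // => /eqP->.
Qed.

Lemma uniq_string pi w : perm_eq (flatten pi) (enum 'I_n) -> w \in pi -> uniq w.
Proof.
move=> pe wpi; have : uniq (flatten pi) by rewrite (perm_uniq pe) enum_uniq.
case/splitPr: wpi => p1 p2.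
by rewrite flatten_cat /= !cat_uniq => /and3P[_ _ /and3P[]].
Qed.

Section Involution.
Variables (mu : seq nat) (pi : seq (seq 'I_n)).
Hypothesis hpi : mu_involution mu pi.

Let pe : perm_eq (flatten pi) (enum 'I_n).
Proof. by case/and3P: hpi. Qed.

Lemma blk_mem x : nth [::] pi (blk pi x) \in pi.
Proof. by rewrite mem_nth // blk_lt. Qed.

Lemma blk_pi_perm x : blk pi (pi_perm pi x) = blk pi x.
Proof. by apply/eqP; rewrite -nth_blk // string_perm_mem // mem_blk. Qed.

Lemma pi_permK : involutive (pi_perm pi).
Proof.
move=> x; rewrite {1}/pi_perm blk_pi_perm /pi_perm.
have /and3P[_ _ /allP/(_ _ (blk_mem x))/allP/(_ x)] := hpi.
by rewrite mem_blk // => /(_ isT)/eqP.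
Qed.

End Involution.

(** Sort the letters by decreasing string index and keep the first [i]. *)
Lemma exists_topset pi i : (i <= n)%N -> exists I : isubset n i, topset pi (val I).
Proof.
move=> le_in; pose r x y := (blk pi y <= blk pi x)%N.
have rt : transitive r by move=> y x z xy yz; exact: leq_trans yz xy.
have rtot : total r by move=> x y; exact: leq_total.
pose s := sort r (enum 'I_n).
have us : uniq s by rewrite sort_uniq enum_uniq.
have ms x : x \in s by rewrite mem_sort mem_enum.
pose I := [set x in take i s].
have cI : #|I| == i.
  rewrite cardsE (card_uniqP (take_uniq i us)) size_takel //.
  by rewrite size_sort size_enum_ord.
exists (exist _ I cI); apply/topsetP => x /= xI y; rewrite !inE in xI * => yI.
have : pairwise r s by rewrite -sorted_pairwise // sort_sorted.
rewrite -(cat_take_drop i s) pairwise_cat => /and3P[/allrelP all_r _ _].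
apply: all_r => //; have := ms y; rewrite -{1}(cat_take_drop i s) mem_cat.
by rewrite (negPf yI).
Qed.

(** An exchange argument through a threshold [c], the maximum of [f] on the top set: [f - c] is at
    most 0 on that set and at least 0 off it, so the sums of [f - c] compare letter by letter. Equal
    cardinalities make the shift by [c] harmless. *)
Lemma topset_leif pi (f : 'I_n -> int) (I J : {set 'I_n}) :
  (forall x y, (f x <= f y) = (blk pi y <= blk pi x)%N) ->
  (0 < #|I|)%N -> #|I| = #|J| -> topset pi I ->
  \sum_(x in I) f x <= \sum_(x in J) f x ?= iff topset pi J.
Proof.
move=> fE I0 cIJ tI.
have fP (K : {set 'I_n}) : reflect {in K, forall x y, y \notin K -> f x <= f y} (topset pi K).
  by apply: (iffP (topsetP _ _)) => h x xK y yK; move: (h x xK y yK); rewrite fE.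
(* The converse of the equality case follows by exchanging the two top sets. *)
suff H (K L : {set 'I_n}) : (0 < #|K|)%N -> #|K| = #|L| -> topset pi K ->
    \sum_(x in K) f x <= \sum_(x in L) f x /\
    (\sum_(x in K) f x = \sum_(x in L) f x -> topset pi L).
  have [le eq] := H _ _ I0 cIJ tI; split=> //; apply/eqP/idP => // tJ.
  have J0 : (0 < #|J|)%N by rewrite -cIJ.
  by apply/le_anti; rewrite le; have [-> _] := H J I J0 (esym cIJ) tJ.
move=> K0 cKL /fP tK; have [x0 x0K] := card_gt0P K0.
pose c := f [arg max_(x > x0 in K) f x]%O.
have [cK cN] : (forall x, x \in K -> f x <= c) /\ (forall y, y \notin K -> c <= f y).
  by rewrite /c; case: arg_maxP => //= x xK mx; split=> // y; apply: tK.
have sumE (M : {set 'I_n}) : \sum_(x in M) f x =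
    \sum_x (if x \in M then f x - c else 0) + c *+ #|M|.
  by rewrite -big_mkcond /= sumrB sumr_const subrK.
have pw x : (if x \in K then f x - c else 0) <= (if x \in L then f x - c else 0)
    ?= iff ((if x \in K then f x - c else 0) == (if x \in L then f x - c else 0)).
  split=> //; case: ifP => xK; case: ifP => xL //; first by rewrite subr_le0 cK.
  by rewrite subr_ge0 cN // xK.
have [le eq] := leif_sum (P := predT) (fun x _ => pw x).
rewrite !sumE cKL; split=> [|/addIr/eqP]; first by rewrite lerD2r.
rewrite eq => /forall_inP eqx; apply/fP => x xL y yL.
apply: (@le_trans _ _ c).
  case: (boolP (x \in K)) => [/cK //|xK]; have := eqx x isT.
  by rewrite (negPf xK) xL eq_sym subr_eq0 => /eqP->.
case: (boolP (y \in K)) => [yK|/cN //]; have := eqx y isT.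
by rewrite yK (negPf yL) subr_eq0 => /eqP->.
Qed.

(** Two top sets of the same size differ only inside one string, on which [f] is constant. *)
Lemma topset_prod (R : comNzRingType) pi (f : 'I_n -> R) (I J : {set 'I_n}) :
  (forall x y, blk pi x = blk pi y -> f x = f y) ->
  #|I| = #|J| -> topset pi I -> topset pi J ->
  \prod_(x in I) f x = \prod_(x in J) f x.
Proof.
move=> fE cIJ /topsetP tI /topsetP tJ.
have cD : #|I :\: J| = #|J :\: I|.
  apply/eqP; by rewrite -(eqn_add2l #|I :&: J|) cardsID setIC cardsID cIJ.
rewrite (big_setID J) [RHS](big_setID I) /= setIC; congr (_ * _).
have [e|[x0 x0I]] := set_0Vmem (I :\: J).
  have /cards0_eq-> : #|J :\: I| = 0 by rewrite -cD e cards0.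
  by rewrite e !big_set0.
have eq x y : x \in I :\: J -> y \in J :\: I -> blk pi x = blk pi y.
  rewrite !inE => /andP[xJ xI] /andP[yI yJ]; apply/eqP.
  by rewrite eqn_leq (tI x xI y yI) (tJ y yJ x xJ).
have [y0 y0J] : exists y, y \in J :\: I.
  by apply/card_gt0P; rewrite -cD; apply/card_gt0P; exists x0.
rewrite (eq_bigr (fun=> f y0)) => [|x xI]; last exact/fE/eq.
rewrite [RHS](eq_bigr (fun=> f y0)) => [|y yJ]; first by rewrite !prodr_const cD.
by apply: fE; rewrite -(eq _ _ x0I yJ) (eq _ _ x0I y0J).
Qed.

End Blocks.

(** * Coordinate flags and their quadratic forms *)

Section Coordinates.
Variables (k : fieldType) (n : nat).

Lemma mem_span_delta (s : seq 'I_n) (v : 'cV[k]_n) :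
  reflect (forall a, a \notin s -> v a 0 = 0)
    (v \in <<[seq (delta_mx a ord0 : 'cV[k]_n) | a <- s]>>%VS).
Proof.
apply: (iffP idP) => [|v0].
  elim: s v => [|b s IH] v /=; first by rewrite span_nil memv0 => /eqP-> a _; rewrite mxE.
  rewrite span_cons => /memv_addP[_ /vlineP[c ->] [u us ->]] a.
  rewrite inE negb_or => /andP[/negPf ab as0].
  by rewrite !mxE ab IH // mulr0 addr0.
have -> : v = \sum_a v a 0 *: delta_mx a ord0.
  apply/matrixP => x y; rewrite ord1 summxE (bigD1 x) //= !mxE !eqxx mulr1.
  by rewrite big1 ?addr0 // => z zx; rewrite !mxE eq_sym (negPf zx) mulr0.
apply: rpred_sum => a _; have [as0|/v0->] := boolP (a \in s).
  by apply/memvZ/memv_span/map_f.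
by rewrite scale0r rpred0.
Qed.

Definition bil (A : 'M[k]_n) (u v : 'cV[k]_n) : k := (u^T *m A *m v) 0 0.

Lemma bilE A u v : bil A u v = \sum_x \sum_y u x 0 * A x y * v y 0.
Proof.
rewrite /bil -mulmxA mxE; apply: eq_bigr => x _; rewrite !mxE big_distrr /=.
by apply: eq_bigr => y _; rewrite mulrA.
Qed.

Lemma bil_delta A a b : bil A (delta_mx a 0) (delta_mx b 0) = A a b.
Proof.
rewrite bilE (bigD1 a) //= (bigD1 b) //= !mxE !eqxx mul1r mulr1.
rewrite !big1 ?addr0 // => [x /negPf xa|y /negPf yb].
  by rewrite big1 // => y _; rewrite !mxE xa !mul0r.
by rewrite !mxE yb mulr0.
Qed.

Lemma bil_sym A u v : A^T = A -> bil A u v = bil A v u.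
Proof.
by move=> sA; rewrite /bil -[u^T *m A *m v]trmxK [in LHS]mxE !trmx_mul trmxK sA mulmxA.
Qed.

Lemma qform_polar A u v : A^T = A ->
  qform A (u + v) - qform A u - qform A v = 2 * bil A u v.
Proof.
move=> sA.
have -> : qform A (u + v) = qform A u + qform A v + (bil A u v + bil A v u).
  rewrite /qform /bil (linearD (trmx (m := n) (n := 1))) /= !(mulmxDl, mulmxDr).
  by rewrite ![(_ + _ : matrix _ _ _) 0 0]mxE; ring.
by rewrite (bil_sym v) //; ring.
Qed.

Lemma bil_mono s d u v : bil (mono s d) u v = \sum_x d x * (u x 0 * v (s x) 0).
Proof.
rewrite bilE; apply: eq_bigr => x _; rewrite (bigD1 (s x)) //= !mxE eqxx.
rewrite big1 ?addr0 => [|y /negPf ys]; first by rewrite mulrCA mulrA.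
by rewrite !mxE ys mulr0 mul0r.
Qed.

End Coordinates.

(** * Minors along a degenerating family *)

(* The Leibniz term of [t] is divisible by ['X] to the power
   [\sum_p maxn (f p) (g (t p))], which exceeds [m] unless [f p = g (t p)] for
   all [p]. *)
Lemma det_valuation (k : fieldType) i (B C : 'M[{poly k}]_i) (M : 'M[k]_i)
    (f g : 'I_i -> nat) (m : nat) :
  (forall p q, B p q = 'X^(maxn (f p) (g q)) * C p q) ->
  (forall p q, f p = g q -> (C p q).[0] = M p q) ->
  (forall p q, f p != g q -> M p q = 0) ->
  (m <= \sum_p f p)%N -> (m <= \sum_p g p)%N ->
  exists h : {poly k}, \det B = 'X^m * h /\
    h.[0] = if (m == \sum_p f p)%N && (m == \sum_p g p)%N then \det M else 0.
Proof.
move=> BE CM M0 mf mg.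
pose e (t : 'S_i) := (\sum_p maxn (f p) (g (t p)))%N.
have gt (t : 'S_i) : (\sum_p g (t p) = \sum_p g p)%N by rewrite [RHS](reindex_perm t).
have me t : (m <= e t)%N.
  by apply: leq_trans mf _; apply: leq_sum => p _; exact: leq_maxl.
have eqe (t : 'S_i) : (m == \sum_p f p)%N && (m == \sum_p g p)%N ->
    (forall p, f p = g (t p)) -> e t = m.
  by case/andP=> /eqP-> _ fg; apply: eq_bigr => p _; rewrite -fg maxnn.
have eqi (t : 'S_i) : e t = m -> [/\ (m == \sum_p f p)%N, (m == \sum_p g p)%N
    & forall p, f p = g (t p)].
  move=> et.
  have [lef ef] := leqif_sum (P := predT) (fun p _ => leqif_eq (leq_maxl (f p) (g (t p)))).
  have [leg eg] := leqif_sum (P := predT) (fun p _ => leqif_eq (leq_maxr (f p) (g (t p)))).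
  rewrite -/(e t) et in lef ef leg eg; rewrite gt in leg eg.
  have fm : (m == \sum_p f p)%N by rewrite eqn_leq mf lef.
  have gm : (m == \sum_p g p)%N by rewrite eqn_leq mg leg.
  split=> // p; move: ef eg; rewrite -(eqP fm) -(eqP gm) eqxx.
  move=> /esym/forall_inP/(_ p isT)/eqP f_max /esym/forall_inP/(_ p isT)/eqP g_max.
  by rewrite [LHS]f_max -g_max.
exists (\sum_(t : 'S_i) (-1) ^+ t * 'X^(e t - m) * \prod_p C p (t p)); split.
  rewrite /determinant big_distrr; apply: eq_bigr => t _ /=.
  under eq_bigr do rewrite BE.
  rewrite big_split /= prodrXr -/(e t) -{1}(subnK (me t)) exprD.
  by rewrite -!mulrA [RHS]mulrCA; congr (_ * _); rewrite mulrCA.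
rewrite horner_sum; case: ifP => [mm|nmm].
  apply: eq_bigr => t _; rewrite !hornerM hornerXn horner_prod horner_exp.
  rewrite hornerN hornerC.
  have [fg|/forallPn[p fp]] := boolP [forall p, f p == g (t p)].
    have fgE p : f p = g (t p) by apply/eqP/(forallP fg).
    rewrite (eqe t mm fgE) subnn expr0 mulr1; congr (_ * _).
    by apply: eq_bigr => p _; apply: CM.
  rewrite [in RHS](bigD1 p) //= M0 // mul0r mulr0.
  suff : (m < e t)%N by rewrite -subn_gt0; case: (e t - m)%N => // d _; rewrite expr0n mulr0 mul0r.
  rewrite ltn_neqAle me andbT; apply: contra fp => /eqP/esym/eqi[_ _ ->].
  by [].
apply: big1 => t _; rewrite !hornerM hornerXn.
suff : (m < e t)%N by rewrite -subn_gt0; case: (e t - m)%N => // d _; rewrite expr0n mulr0 mul0r.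
rewrite ltn_neqAle me andbT; apply: contraFN nmm => /eqP/esym/eqi[-> -> _].
by [].
Qed.

(** * The point of a degenerate involution *)

Section Point.
Variables (k : closedFieldType) (n : nat).
Hypothesis char0 : [pchar k] =i pred0.

(** The half is there because a symmetric matrix contributes the product of the two coordinates of a
    two-cycle twice. *)
Definition cycle_coef (s : 'I_n -> 'I_n) x : k := if s x == x then 1 else 2^-1.

Definition inv_mx pi : 'M[k]_n := mono (pi_perm pi) (cycle_coef (pi_perm pi)).

Definition top_minors pi i : 'M[k]_(extdim n i) :=
  \matrix_(p, q) (if topset pi (val (enum_val p)) && topset pi (val (enum_val q))
                  then extmx i (inv_mx pi) p q else 0).

Lemma two_neq0 : (2 : k) != 0.
Proof. by move/pcharf0P: char0 => ->. Qed.

Lemma cycle_coef_neq0 s x : cycle_coef s x != 0.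
Proof. by rewrite /cycle_coef; case: ifP; rewrite ?oner_neq0 // invr_eq0 two_neq0. Qed.

Lemma cycle_coef_inv s x : involutive s -> cycle_coef s (s x) = cycle_coef s x.
Proof. by move=> sK; rewrite /cycle_coef (inj_eq (inv_inj sK)). Qed.

Variables (mu : seq nat) (pi : seq (seq 'I_n)).
Hypotheses (hmu : is_composition n mu) (hpi : mu_involution mu pi).

Let pe : perm_eq (flatten pi) (enum 'I_n).
Proof. by case/and3P: hpi. Qed.
Let r := size pi.
Let s := pi_perm pi.
Let M := inv_mx pi.
Let sK : involutive s := pi_permK hpi.
(** The exponent of the parameter that [cq_family] attaches to the string of [x]. *)
Let w x := (r - (blk pi x).+1)%N.
Let wsum (I : {set 'I_n}) := (\sum_(x in I) w x)%N.

Let blk_r x : (blk pi x < r)%N := blk_lt x pe.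

Let blk_s x : blk pi (s x) = blk pi x := blk_pi_perm hpi x.

Let w_s x : w (s x) = w x.
Proof. by rewrite /w blk_s. Qed.

Lemma string_nonempty j : (j < r)%N -> exists x, blk pi x = j.
Proof.
move=> jr; have /and3P[/eqP sh _ _] := hpi; have /andP[/allP pos _] := hmu.
have : (0 < size (nth [::] pi j))%N.
  by apply: pos; rewrite -sh; apply/map_f/mem_nth.
case E : (nth [::] pi j) => [//|x u] _; exists x; apply/eqP.
by rewrite -nth_blk // E mem_head.
Qed.

Definition string_form_mx j : 'M[k]_n :=
  mono s (fun x => if blk pi x == j then cycle_coef s x else 0).

Lemma block_mx_sym j : (string_form_mx j)^T = string_form_mx j.
Proof. by apply: mono_sym => // x; rewrite blk_s cycle_coef_inv. Qed.

Lemma mem_flag j (v : 'cV[k]_n) :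
  reflect (forall a, (j <= blk pi a)%N -> v a 0 = 0) (v \in cq_flag (cq_of k pi) j).
Proof.
apply: (iffP (mem_span_delta _ _)) => v0 a ja; apply: v0.
  by rewrite flatten_take_blk // -leqNgt.
by rewrite leqNgt -flatten_take_blk.
Qed.

Lemma delta_flag j a : (blk pi a < j)%N -> (delta_mx a 0 : 'cV[k]_n) \in cq_flag (cq_of k pi) j.
Proof.
move=> aj; apply/mem_flag => b jb; rewrite mxE; case: eqP => // e.
by move: jb; rewrite e leqNgt aj.
Qed.

(** [cq_form] meets a two-cycle once, at its smaller letter; the matrix meets it at both letters,
    each time with coefficient one half. *)
Lemma form_qform j v : (j < r)%N -> cq_form (cq_of k pi) j v = qform (string_form_mx j) v.
Proof.
move=> jr; rewrite -[RHS]/(bil _ v v) bil_mono /=.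
have uw : uniq (nth [::] pi j) by apply: uniq_string pe _; rewrite mem_nth.
have spE a : blk pi a = j -> string_perm (nth [::] pi j) a = s a.
  by rewrite /s /pi_perm => ->.
have -> : \sum_x (if blk pi x == j then cycle_coef s x else 0) * (v x 0 * v (s x) 0)
    = \sum_(x | blk pi x == j) cycle_coef s x * (v x 0 * v (s x) 0).
  by rewrite [RHS]big_mkcond; apply: eq_bigr => x _; case: eqP; rewrite ?mul0r.
rewrite [RHS](bigID (fun x => s x == x)) /= [RHS]addrC; congr (_ + _); last first.
  rewrite big_mkcond big_uniq //= -big_mkcondr /=; apply: eq_big => [a|a].
    rewrite nth_blk //; case: (blk pi a =P j) => //= e; by rewrite spE.
  case/andP; rewrite nth_blk // => /eqP aj; rewrite spE // => /eqP sa.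
  by rewrite /cycle_coef sa eqxx mul1r expr2.
rewrite big_mkcond big_uniq //= -big_mkcondr /=.
rewrite [RHS](bigID (fun x : 'I_n => (x < s x)%N)) /=.
have E (P : pred 'I_n) : (forall x, P x -> s x != x) ->
    \sum_(x | P x) cycle_coef s x * (v x 0 * v (s x) 0) =
    2^-1 * \sum_(x | P x) (v x 0 * v (s x) 0).
  move=> Pn; rewrite big_distrr; apply: eq_bigr => x /Pn /negPf e.
  by rewrite /cycle_coef e.
rewrite !E; try by [move=> x /andP[/andP[]]].
(* Applying [s] turns the sum over larger letters of two-cycles into the sum over smaller ones. *)
rewrite [X in _ = _ + 2^-1 * X](reindex_inj (inv_inj sK)) /=.
have -> : \sum_(x | (blk pi (s x) == j) && (s (s x) != s x) && ~~ (s x < s (s x))%N)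
      v (s x) 0 * v (s (s x)) 0 =
    \sum_(x | (blk pi x == j) && (s x != x) && (x < s x)%N) v x 0 * v (s x) 0.
  apply: eq_big => [x|x _]; last by rewrite sK mulrC.
  rewrite blk_s sK [x == s x]eq_sym -leqNgt -!andbA; congr (_ && _).
  by rewrite ltn_neqAle -[(x : nat) == s x]/(x == s x) eq_sym andbA andbb.
rewrite -mulrDl -[2^-1]mul1r -mulrDl -mulr2n mulfV ?two_neq0 ?mul1r //.
apply: eq_big => [x|x /andP[]]; last by rewrite nth_blk // => /eqP xj; rewrite spE.
rewrite nth_blk //; case: (blk pi x =P j) => //= e; rewrite spE //.
by case: eqP => // ->; rewrite ltnn.
Qed.


Lemma bil_block_flag j u v : u \in cq_flag (cq_of k pi) j ->
  bil (string_form_mx j) v u = 0.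
Proof.
move/mem_flag=> u0; rewrite bil_mono big1 // => x _.
by case: eqP => [xj|]; rewrite ?mul0r // u0 ?mulr0 // blk_s xj.
Qed.

Lemma cq_of_complete : is_complete_quadric (cq_of k pi).
Proof.
have dF a j : ((delta_mx a 0 : 'cV[k]_n) \in cq_flag (cq_of k pi) j) = (blk pi a < j)%N.
  apply/idP/idP => [/mem_flag h|]; last exact: delta_flag.
  rewrite ltnNge; apply/negP => /h/eqP; rewrite !mxE !eqxx.
  exact/negP/oner_neq0.
split.
- by rewrite /= take0 span_nil.
- apply/vspaceP => v; rewrite memvf; apply/mem_flag => a.
  by rewrite leqNgt blk_r.
- move=> j jr; apply/andP; split.
    apply/subvP => v /mem_flag v0; apply/mem_flag => a ja.
    by apply: v0; exact: ltnW.
  have [x xj] := string_nonempty jr.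
  by apply/eqP => /vspaceP/(_ (delta_mx x 0)); rewrite !dF xj ltnn ltnSn.
- move=> j jr; split.
  + exists (string_form_mx j); first exact: block_mx_sym.
    by move=> v _; exact: form_qform.
  + move=> u v /bil_block_flag u0 _; rewrite !form_qform //.
    have := qform_polar u v (block_mx_sym j).
    rewrite bil_sym ?block_mx_sym // u0 [qform _ u]u0 mulr0 subr0 => /eqP; by rewrite subr_eq0 => /eqP.
  + move=> v /mem_flag vj v0; apply/mem_flag => a.
    rewrite leq_eqVlt => /orP[/eqP ja|]; last exact: vj.
    (* Pairing [v] with the basis vector of [s a] isolates the coordinate [v a 0], up to the nonzero
       factor [2 * cycle_coef s a]. *)
    have aj1 : (blk pi (s a) < j.+1)%N by rewrite blk_s ja.
    have := v0 _ (delta_flag aj1); rewrite !form_qform // qform_polar ?block_mx_sym //.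
    rewrite bil_mono (bigD1 a) //= -ja eqxx big1 ?addr0.
      rewrite mxE !eqxx mulr1 => /eqP; rewrite !mulf_eq0 (negPf two_neq0).
      by rewrite (negPf (cycle_coef_neq0 _ _)) => /eqP.
    move=> x /negPf xa; rewrite [delta_mx _ _ _ _]mxE (inj_eq (inv_inj sK)) xa.
    by rewrite !mulr0.
Qed.

(** The [i]-th flag space is the sum of the [W] of index below [i], and [A j] kills each of them. *)
Lemma splitting_kills W A j i v : cq_splitting (cq_of k pi) W A -> (j < r)%N ->
  (i <= j)%N -> v \in cq_flag (cq_of k pi) i -> A j *m v = 0.
Proof.
move=> spl jr; elim: i v => [|i IH] v ij.
  by have [-> _ _ _] := cq_of_complete; rewrite memv0 => /eqP->; rewrite mulmx0.
have ir : (i < r)%N by apply: ltn_trans ij jr.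
have [[<- _] _ _ _] := spl i ir; case/memv_addP => u uF [u' u'W ->].
rewrite mulmxDr IH ?(ltnW ij) // add0r.
have [_ _ _ kill] := spl j jr; apply: kill u'W => //.
by rewrite neq_ltn ij.
Qed.

Lemma splitting_low W A j a b : cq_splitting (cq_of k pi) W A -> (j < r)%N ->
  (minn (blk pi a) (blk pi b) < j)%N -> A j a b = 0.
Proof.
move=> spl jr.
have low x y : (blk pi y < j)%N -> A j x y = 0.
  move=> yj; rewrite -(bil_delta (A j)) /bil -mulmxA.
  by rewrite (splitting_kills spl jr (leqnn j) (delta_flag yj)) mulmx0 mxE.
have [_ sA _ _] := spl j jr; rewrite gtn_min => /orP[aj|]; last exact: low.
by rewrite -sA mxE low.
Qed.

(** Source of the independence of the splitting: [A j] and [string_form_mx j] both have [V_j] in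
    their radical and give the same form on [W j], hence on [V_(j+1)]; polarization recovers the
    entries. *)
Lemma splitting_diag W A j a b : cq_splitting (cq_of k pi) W A -> (j < r)%N ->
  blk pi a = j -> blk pi b = j -> A j a b = inv_mx pi a b.
Proof.
move=> spl jr aj bj; have [[fE _] sA qA _] := spl j jr.
have qE v : v \in cq_flag (cq_of k pi) j.+1 -> qform (A j) v = qform (string_form_mx j) v.
  rewrite -fE => /memv_addP[u uF [u' u'W ->]].
  have Ak : bil (A j) u u' = 0 /\ qform (A j) u = 0.
    have Au := splitting_kills spl jr (leqnn j) uF.
    split; last by rewrite /qform -mulmxA Au mulmx0 mxE.
    by rewrite /bil -{1}sA -trmx_mul Au trmx0 mul0mx mxE.
  have Bk : bil (string_form_mx j) u u' = 0 /\ qform (string_form_mx j) u = 0.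
    have Bu x := bil_block_flag x uF; split; last exact: Bu.
    by rewrite bil_sym ?block_mx_sym.
  have := qform_polar u u' sA; have := qform_polar u u' (block_mx_sym j).
  case: Ak Bk => -> -> [-> ->]; rewrite !mulr0 !subr0.
  move/eqP; rewrite subr_eq0 => /eqP-> /eqP; rewrite subr_eq0 => /eqP->.
  by rewrite qA // form_qform.
have aF : (delta_mx a 0 : 'cV[k]_n) \in cq_flag (cq_of k pi) j.+1.
  by apply: delta_flag; rewrite aj.
have bF : (delta_mx b 0 : 'cV[k]_n) \in cq_flag (cq_of k pi) j.+1.
  by apply: delta_flag; rewrite bj.
have := qform_polar (delta_mx a 0) (delta_mx b 0) sA.
have := qform_polar (delta_mx a 0) (delta_mx b 0) (block_mx_sym j).
rewrite !qE ?memvD // => -> /(mulfI two_neq0); rewrite !bil_delta => <-.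
by rewrite !mxE aj eqxx.
Qed.

Lemma standard_splitting : cq_splitting (cq_of k pi)
  (fun j => <<[seq (delta_mx a ord0 : 'cV[k]_n) | a <- nth [::] pi j]>>%VS)
  string_form_mx.
Proof.
have mW j (v : 'cV[k]_n) : reflect (forall a, blk pi a != j -> v a 0 = 0)
    (v \in <<[seq (delta_mx a ord0 : 'cV[k]_n) | a <- nth [::] pi j]>>%VS).
  apply: (iffP (mem_span_delta _ _)) => v0 a ja; apply: v0.
    by rewrite nth_blk.
  by rewrite -nth_blk.
move=> j jr; split.
- split; last first.
    apply/eqP; rewrite -subv0; apply/subvP => v; rewrite memv_cap.
    case/andP=> /mem_flag vF /mW vW; rewrite memv0; apply/eqP/matrixP => a b.
    rewrite ord1 mxE; have [e|] := eqVneq (blk pi a) j; last exact: vW.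
    by apply: vF; rewrite e.
  rewrite /= -span_cat -map_cat; congr <<map _ _>>%VS.
  by rewrite (take_nth [::]) // flatten_rcons.
- exact: block_mx_sym.
- by move=> v _; rewrite form_qform.
- move=> i ir ij v /mW vW; apply/matrixP => a b; rewrite ord1 !mxE.
  apply: big1 => c _; rewrite mxE; case: eqP => [->|]; rewrite ?mul0r //.
  by case: eqP => [aj|]; rewrite ?mul0r // vW ?mulr0 // blk_s aj eq_sym.
Qed.

(** [topset_leif] applies to [w], which decreases strictly with the index of the string. *)
Lemma exists_min_weight i : (0 < i <= n)%N -> exists m, forall p : 'I_(extdim n i),
  (m <= wsum (val (enum_val p)))%N /\
  (m == wsum (val (enum_val p))) = topset pi (val (enum_val p)).
Proof.
case/andP=> i0 ile; have [I tI] := exists_topset pi ile.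
have fE x y : ((w x)%:Z <= (w y)%:Z) = (blk pi y <= blk pi x)%N.
  by rewrite lez_nat /w leq_sub2lE.
exists (wsum (val I)) => p.
have cI : #|val I| = i by exact/eqP/(valP I).
have I0 : (0 < #|val I|)%N by rewrite cI.
have cIp : #|val I| = #|val (enum_val p)| by rewrite card_isubset.
have [] := topset_leif fE I0 cIp tI.
by rewrite -!(big_morph Posz PoszD (erefl _)) lez_nat eqz_nat.
Qed.

(** A nonzero minor forces the column set to be the image under [s] of the row set, and [s]
    preserves the weight, whose minimum characterizes top sets. *)
Lemma minor_top i (p q : 'I_(extdim n i)) :
  extmx i (inv_mx pi) p q != 0 ->
  topset pi (val (enum_val p)) = topset pi (val (enum_val q)).
Proof.
rewrite mxE => nz; have i_le : (i <= n)%N.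
  by rewrite -[i](card_isubset p) -[X in (_ <= X)%N](card_ord n) max_card.
(* The empty set is treated apart, since [exists_min_weight] concerns nonempty sets. *)
case: i => [|i] in p q nz i_le *.
  have e (u : 'I_(extdim n 0)) : val (enum_val u) = set0.
    by apply/cards0_eq; rewrite card_isubset.
  by rewrite !e.
have [m mP] := @exists_min_weight i.+1 i_le.
have [_ <-] := mP p; have [_ <-] := mP q.
by rewrite /wsum (big_minor_mono _ w nz); under [in RHS]eq_bigr do rewrite w_s.
Qed.

Lemma top_minors_neq0 i : (i <= n)%N ->
  exists p q, top_minors pi i p q != 0.
Proof.
move=> ile; have [I tI] := exists_topset pi ile.
have cJ : #|s @: val I| == i by rewrite card_imset ?(valP I) //; exact: inv_inj.
pose J : isubset n i := exist _ (s @: val I) cJ.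
exists (enum_rank I), (enum_rank J).
have nz : extmx i (inv_mx pi) (enum_rank I) (enum_rank J) != 0.
  rewrite mxE !enum_rankK; apply: minor_mono_neq0 => // [x|x xI].
    exact: cycle_coef_neq0.
  exact: imset_f.
by rewrite mxE -(minor_top nz) enum_rankK tI.
Qed.

(** The splitting is arbitrary here: only the vanishing from [splitting_low] and the diagonal blocks
    from [splitting_diag] enter the leading coefficients. *)
Lemma represents_unique pt : represents (cq_of k pi) pt ->
  forall i, pt i = <[top_minors pi (nat_of_ord i).+1]>%VS.
Proof.
case=> _ [W [A [spl lim]]].
pose B : 'M[{poly k}]_n := \matrix_(x, y) \sum_(j < r) A j x y *: 'X^(r - j.+1).
(* [C] is [B] with the power [maxn (w x) (w y)] of the variable factored out of each entry; the
   discarded indices [j] have a zero entry in [A j]. *)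
pose C : 'M[{poly k}]_n := \matrix_(x, y)
  \sum_(j < r | (j <= minn (blk pi x) (blk pi y))%N) A j x y *: 'X^(minn (blk pi x) (blk pi y) - j).
have BC x y : B x y = 'X^(maxn (w x) (w y)) * C x y.
  rewrite !mxE big_distrr /= [RHS]big_mkcond /=; apply: eq_bigr => j _.
  case: leqP => [le|lt]; last by rewrite (splitting_low spl) ?scale0r.
  rewrite -scalerAr -exprD; congr (_ *: 'X^_).
  have := blk_r x; have := blk_r y; rewrite /w.
  by clear -le; lia.
have CM x y : w x = w y -> (C x y).[0] = M x y.
  move=> wxy; have bxy : blk pi x = blk pi y.
    by have := blk_r x; have := blk_r y; move: wxy; rewrite /w; clear; lia.
  rewrite mxE horner_sum bxy minnn (bigD1 (Ordinal (blk_r y))) //= subnn hornerZ.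
  rewrite hornerC mulr1 (splitting_diag spl) //.
  rewrite big1 ?addr0 // => j /andP[le ne]; rewrite hornerZ hornerXn expr0n subn_eq0.
  by rewrite leqNgt ltn_neqAle le andbT -[_ != _ :> nat]/(j != Ordinal (blk_r y)) ne mulr0.
have M0 x y : w x != w y -> M x y = 0.
  by rewrite mxE => /negP h; case: eqP => // e; case: h; rewrite e w_s.
have sz (i : 'I_n.-1) : (0 < i.+1 <= n)%N by have := ltn_ord i; clear; lia.
have [m mP] := fin_all_exists (fun i => exists_min_weight (sz i)).
have hP (i : 'I_n.-1) p q : exists h : {poly k},
    extmx i.+1 B p q = 'X^(m i) * h /\ h.[0] = top_minors pi i.+1 p q.
  have [lp tp] := mP i p; have [lq tq] := mP i q.
  have [|||||h [hB h0]] := @det_valuation k i.+1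
    (mxsub (isubset_nth (enum_val p)) (isubset_nth (enum_val q)) B)
    (mxsub (isubset_nth (enum_val p)) (isubset_nth (enum_val q)) C)
    (mxsub (isubset_nth (enum_val p)) (isubset_nth (enum_val q)) M)
    (w \o isubset_nth (enum_val p)) (w \o isubset_nth (enum_val q)) (m i).
  - by move=> u v; rewrite mxE BC [in RHS]mxE.
  - by move=> u v /CM; rewrite !mxE.
  - by move=> u v /M0; rewrite !mxE.
  - by rewrite /= big_isubset.
  - by rewrite /= big_isubset.
  exists h; split; first by rewrite mxE hB.
  by rewrite h0 /= !big_isubset -/(wsum _) -/(wsum _) tp tq !mxE.
have [h hh] := fin_all_exists (fun i => fin_all_exists (fun p => fin_all_exists (hP i p))).
(* The minors of the family divided by their common power [m i]: the same lines for [t != 0], and a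
   nonzero value at 0. *)
pose H i : 'M[{poly k}]_(extdim n (nat_of_ord i).+1) := \matrix_(p, q) h i p q.
have H0 i : map_mx (horner_eval 0) (H i) = top_minors pi i.+1.
  by apply/matrixP => p q; rewrite 2!mxE /horner_eval; case: (hh i p q).
move=> i; rewrite (limit_unique (h := H) lim) ?H0 // => {i} [t i t0|i].
  rewrite -(@vline_scale _ _ (t ^+ m i) (map_mx (horner_eval t) (H i))) ?expf_neq0 //.
  congr <[_]>%VS; apply/matrixP => p q; rewrite [RHS]mxE ![in RHS]mxE /horner_eval.
  rewrite -hornerXn -hornerM; have [<- _] := hh i p q.
  rewrite !mxE -[RHS]/(horner_eval t _) -det_map_mx; congr (\det _).
  apply/matrixP => u v; rewrite !mxE /= /horner_eval horner_sum summxE.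
  by apply: eq_bigr => j _; rewrite !mxE hornerZ hornerXn mulrC.
have [|p [q]] := @top_minors_neq0 i.+1; first by case/andP: (sz i).
by move=> nz; apply: contraNneq nz => e; rewrite -H0 e mxE.
Qed.


(** * Translates of the point by diagonal matrices, as limits of nondegenerate quadrics *)

Section Scaling.
Variable e : 'I_n -> k.
Hypothesis e_neq0 : forall x, e x != 0.

(** Used twice: [e = 1] gives the point itself, and the inverse entries of a diagonal matrix give
    its translate, which is thus seen to lie in the variety without a proof that the action
    preserves the closure. *)
Definition scaled_top_minors i : 'M[k]_(extdim n i) :=
  \matrix_(p < extdim n i, q < extdim n i) (\prod_(x in val (enum_val p)) e x * top_minors pi i p q *
                  \prod_(y in val (enum_val q)) e y).

(** The power of [t] sits on the rows alone, yet the matrix is symmetric: [M] is supported on pairs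
    [(x, s x)], whose letters have equal weight. *)
Let fam t : 'M[k]_n := \matrix_(x, y) (t ^+ w x * e x * M x y * e y).

Let fam_minor t i (p q : 'I_(extdim n i)) : extmx i (fam t) p q =
  t ^+ wsum (val (enum_val p)) * (\prod_(x in val (enum_val p)) e x *
    extmx i M p q * \prod_(y in val (enum_val q)) e y).
Proof.
rewrite mxE (det_minor_scale (fun x => t ^+ w x * e x)) big_split /= prodrXr.
by rewrite mxE !mulrA.
Qed.

Let prod_neq0 (I : {set 'I_n}) : \prod_(x in I) e x != 0.
Proof. by apply/prodf_neq0. Qed.

Lemma scaled_top_minors_neq0 (i : 'I_n.-1) : scaled_top_minors i.+1 != 0.
Proof.
have [|p [q nz]] := @top_minors_neq0 i.+1; first by have := ltn_ord i; clear; lia.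
by apply/matrix0Pn; exists p, q; rewrite mxE !mulf_neq0.
Qed.

Let fam_nondegenerate t : t != 0 -> nondegenerate_quadric (quadric_lines (fam t)).
Proof.
move=> t0; exists (fam t).
have -> : fam t = mono s (fun x => t ^+ w x * e x * e (s x) * cycle_coef s x).
  apply/matrixP => x y; rewrite !mxE; case: eqP => [->|]; last by rewrite mulr0 mul0r.
  by rewrite mulrAC.
split=> //.
  by apply: mono_unit => // x; rewrite !mulf_neq0 ?expf_neq0 ?cycle_coef_neq0.
apply: mono_sym => // x; rewrite w_s sK cycle_coef_inv //.
by rewrite [_ * e (s x) * e x]mulrAC.
Qed.

Lemma scaled_limit : limit_at0 (fun t => quadric_lines (fam t))
  (fun i => <[scaled_top_minors (nat_of_ord i).+1]>%VS).
Proof.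
have sz (i : 'I_n.-1) : (0 < i.+1 <= n)%N by have := ltn_ord i; clear; lia.
have [m mP] := fin_all_exists (fun i => exists_min_weight (sz i)).
pose Z (i : 'I_n.-1) : 'M[k]_(extdim n (nat_of_ord i).+1) := \matrix_(p < extdim n i.+1, q < extdim n i.+1)
  (\prod_(x in val (enum_val p)) e x * extmx i.+1 M p q *
   \prod_(y in val (enum_val q)) e y).
apply: (@monomial_limit _ _ _ Z (fun i => scaled_top_minors (nat_of_ord i).+1)
  (fun i p _ => (wsum (val (enum_val p)))%:Z) (fun i => (m i)%:Z)) => [t t0|t i t0|i p q _|i p q|i].
- apply: subset_closure; last exact: fam_nondegenerate.
  move=> i; rewrite dim_vline; case: eqP => // /matrixP f0.
  have [|p [q nz]] := @top_minors_neq0 i.+1; first by case/andP: (sz i).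
  have := f0 p q; rewrite fam_minor [RHS]mxE => /eqP.
  rewrite !mulf_eq0 !(negPf (prod_neq0 _)) (negPf (expf_neq0 _ t0)) /= orbF => /eqP M0.
  by move: nz; rewrite mxE -/M M0; case: ifP => _ /eqP.
- congr <[_]>%VS; apply/matrixP => p q; rewrite fam_minor [RHS]mxE; congr (_ * _).
  by rewrite [RHS]mxE.
- by rewrite lez_nat; case: (mP i p).
- rewrite eqz_nat eq_sym; have [_ ->] := mP i p; rewrite [LHS]mxE.
  rewrite [top_minors _ _ _ _]mxE [Z i p q]mxE.
  (* The exponent sees only the row set; where the minor is nonzero, row and column sets are top
     together. *)
  have [M0|nz] := eqVneq (extmx i.+1 M p q) 0.
    by rewrite -/M M0 if_same mulr0 mul0r if_same.
  by rewrite (minor_top nz) andbb -/M; case: ifP; rewrite ?mulr0 ?mul0r.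
- exact: scaled_top_minors_neq0.
Qed.

Lemma scaled_top_minors_complete :
  complete_quadrics (fun i => <[scaled_top_minors (nat_of_ord i).+1]>%VS).
Proof.
have [psi [[_ cpsi] _ psi0]] := scaled_limit.
exact: zariski_closure_ext psi0 (cpsi 0).
Qed.

End Scaling.

(** Existence of a represented point, from the standard splitting, lets [epsilon_spec] apply;
    uniqueness then identifies the chosen point. *)
Lemma cq_pointE i : cq_point (cq_of k pi) i = <[top_minors pi (nat_of_ord i).+1]>%VS.
Proof.
apply: represents_unique; apply: epsilon_spec.
exists (fun i => <[scaled_top_minors (fun=> 1) (nat_of_ord i).+1]>%VS).
split; first exact: cq_of_complete.
do 2!eexists; split; first exact: standard_splitting.
apply: limit_at0_ext (scaled_limit (fun=> oner_neq0 k)) => // t j t0.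
congr <[extmx _ _]>%VS; apply/matrixP => x y; rewrite !mxE !mulr1.
rewrite summxE (bigD1 (Ordinal (blk_r x))) //= !mxE eqxx big1 ?addr0 //.
move=> b /negPf bx; rewrite !mxE [blk pi x == b]eq_sym.
by rewrite -[_ == _ :> nat]/(b == Ordinal (blk_r x)) bx if_same mulr0.
Qed.

End Point.

(** * Splitting strings into cycles *)

Section Tau.
Variables (n : nat) (mu : seq nat) (pi : seq (seq 'I_n)).
Hypothesis hpi : mu_involution mu pi.

Let pe : perm_eq (flatten pi) (enum 'I_n).
Proof. by case/and3P: hpi. Qed.

Lemma tau_involution :
  exists2 mu', is_composition n mu' & mu_involution mu' (tau pi).
Proof. by have [mu' cmu' [_ h _]] := tau_barred hpi; exists mu'. Qed.

Let pet : perm_eq (flatten (tau pi)) (enum 'I_n).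
Proof. by have [mu' _ /and3P[]] := tau_involution. Qed.

Lemma string_perm_pi w x : w \in pi -> x \in w -> string_perm w x = pi_perm pi x.
Proof. by move=> wpi xw; rewrite /pi_perm -(mem_pi pe wpi xw). Qed.

Lemma cycle_string_mem w c x : w \in pi -> c \in cycle_maxima w ->
  x \in cycle_string w c -> x \in w /\ (x = c \/ x = pi_perm pi c).
Proof.
move=> wpi; rewrite mem_filter mem_sort => /andP[_ cw].
have sw := string_perm_mem cw; rewrite /cycle_string; case: ifP => _.
  by rewrite inE => /eqP->; split=> //; left.
rewrite !inE => /orP[] /eqP->; split=> //; first by left.
by right; exact: string_perm_pi.
Qed.

Lemma string_perm_pair (c b : 'I_n) : (b < c)%N ->
  string_perm [:: c; b] c = b /\ string_perm [:: c; b] b = c.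
Proof.
move=> bc; have cb : (c == b) = false by apply/eqP => e; rewrite e ltnn in bc.
rewrite /string_perm /alphabet /sort /= leqNgt bc /= ?[b == c]eq_sym cb !eqxx /=.
by rewrite ?eqxx.
Qed.

Lemma tau_string x : exists w c, [/\ w \in pi, c \in cycle_maxima w, x \in w &
  nth [::] (tau pi) (blk (tau pi) x) = cycle_string w c].
Proof.
have xu := mem_blk x pet; have ut : nth [::] (tau pi) (blk (tau pi) x) \in tau pi.
  by rewrite mem_nth // blk_lt.
case/flatten_mapP: ut => w wpi /mapP[c cw uE]; exists w, c; split=> //.
by rewrite uE in xu; case: (cycle_string_mem wpi cw xu).
Qed.

(** Each string of [tau pi] is a single cycle of [pi], and a string [ji] with [i < j] exchanges its
    two letters. *)
Lemma tau_perm x : pi_perm (tau pi) x = pi_perm pi x.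
Proof.
have [w [c [wpi cw xw uE]]] := tau_string x.
have xu := mem_blk x pet; rewrite uE in xu; rewrite [LHS]/pi_perm uE.
rewrite -(string_perm_pi wpi xw).
move: cw; rewrite mem_filter mem_sort => /andP[le cw].
have sK : string_perm w (string_perm w c) = c.
  by have /and3P[_ _ /allP/(_ w wpi)/allP/(_ c cw)/eqP] := hpi.
move: xu; rewrite /cycle_string; case: eqP => [e|/eqP ne].
  by rewrite inE => /eqP->; rewrite e /string_perm /alphabet /sort /= eqxx.
have lt : (string_perm w c < c)%N by rewrite ltn_neqAle le andbT.
have [e1 e2] := string_perm_pair lt.
by rewrite !inE => /orP[] /eqP->; rewrite ?e1 ?e2 ?sK.
Qed.

Lemma blk_tau_eq x y : blk (tau pi) x = blk (tau pi) y ->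
  y = x \/ y = pi_perm pi x.
Proof.
move=> e; have [w [c [wpi cw xw uE]]] := tau_string x.
have xu := mem_blk x pet; have yu := mem_blk y pet; rewrite -e in yu.
rewrite uE in xu yu; have sK := pi_permK hpi.
have [_ [->|->]] := cycle_string_mem wpi cw xu;
  have [_ [->|->]] := cycle_string_mem wpi cw yu; rewrite ?sK; by [left|right].
Qed.

(** * The order of the cycles in [tau pi] and its top sets *)

Section Order.
Variable a : 'I_n -> int.
Hypothesis ha : admissible a.

(** A fixed letter counts twice, as it does in the exponent of [t] on a pair of row and column
    sets. *)
Let alpha x := a x + a (pi_perm pi x).

Let alpha_s x : alpha (pi_perm pi x) = alpha x.
Proof. by rewrite /alpha (pi_permK hpi) addrC. Qed.

Let before x y :=
  (blk pi x < blk pi y)%N || (blk pi x == blk pi y) && (alpha x < alpha y).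

(* Admissibility orders the cycles of a string by their largest element. *)
Lemma alpha_lt (c d : 'I_n) : (pi_perm pi c <= c)%N -> (pi_perm pi d <= d)%N ->
  (c < d)%N -> alpha c < alpha d.
Proof.
case: ha => _ mono_a pair_a _ cc dd cd; rewrite /alpha.
(* If [d] is fixed, both letters of the cycle of [c] lie below [d] and condition (b) applies to
   each; otherwise [d] exceeds the other three letters and condition (c) applies. *)
move: dd; rewrite leq_eqVlt => /orP[/eqP/val_inj->|dd].
  by apply: ltrD; apply: mono_a => //; exact: leq_ltn_trans cc cd.
by rewrite [ltRHS]addrC; apply: pair_a => //; exact: leq_ltn_trans cc cd.
Qed.

(** Stated for lists of strings of [pi] so that induction goes through. Cycles from different
    strings are separated by [blk pi], cycles of one string by [alpha], through their strictly
    increasing maxima. *)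
Let pairwise_tau (l : seq (seq 'I_n)) : {subset l <= pi} ->
  pairwise (allrel (fun x y => blk pi x < blk pi y)%N) l ->
  pairwise (allrel before) (tau l).
Proof.
elim: l => // w l IH sl /andP[/allP wl pl].
have wpi : w \in pi by apply: sl; exact: mem_head.
have lpi : {subset l <= pi} by move=> v vl; apply: sl; rewrite inE vl orbT.
rewrite /tau /= -/(tau l) pairwise_cat IH // andbT; apply/andP; split.
  apply/allrelP => u v /mapP[c cw ->] /flatten_mapP[w' w'l /mapP[c' cw' ->]].
  apply/allrelP => x y xu yv; apply/orP; left.
  have [xw _] := cycle_string_mem wpi cw xu.
  have [yw' _] := cycle_string_mem (lpi _ w'l) cw' yv.
  by have /allrelP/(_ x y xw yw') := wl w' w'l.
rewrite pairwise_map.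
have : pairwise (fun c d : 'I_n => c < d)%N (cycle_maxima w).
  rewrite -sorted_pairwise; last by move=> y x z; exact: ltn_trans.
  apply: (sorted_filter (leT := fun c d : 'I_n => (c < d)%N)) => [y x z|].
    exact: ltn_trans.
  have us : uniq (alphabet w) by rewrite sort_uniq (uniq_string pe).
  have le_sorted : sorted (relpre val leq) (alphabet w).
    by apply: sort_sorted => x y; exact: leq_total.
  have : sorted ltn (map val (alphabet w)).
    by rewrite ltn_sorted_uniq_leq map_inj_uniq ?us ?sorted_map //; exact: val_inj.
  by rewrite sorted_map.
apply: (sub_in_pairwise (P := mem (cycle_maxima w))) => [c d cw dw cd|]; last exact/allP.
apply/allrelP => x y xc yd.
have [xw xE] := cycle_string_mem wpi cw xc.
have [yw yE] := cycle_string_mem wpi dw yd.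
apply/orP; right.
have bx : blk pi x = blk pi y.
  apply/eqP; rewrite -nth_blk //; by rewrite -(mem_pi pe wpi yw).
rewrite bx eqxx /=.
have -> : alpha x = alpha c by case: xE => ->.
have -> : alpha y = alpha d by case: yE => ->.
move: cw dw; rewrite !mem_filter !mem_sort => /andP[lec cw] /andP[led dw].
by apply: alpha_lt; rewrite -?(string_perm_pi wpi).
Qed.

Lemma tau_blk_lt x y : (blk (tau pi) x < blk (tau pi) y)%N -> before x y.
Proof.
move=> lt; have pp : pairwise (allrel (fun x y => blk pi x < blk pi y)%N) pi.
  apply/(pairwiseP [::]) => i j ip jp ij; apply/allrelP => u v.
  by rewrite !nth_blk // => /eqP-> /eqP->.
have /(pairwiseP [::]) h := pairwise_tau (fun _ h => h) pp.
have /allrelP := h _ _ (blk_lt x pet) (blk_lt y pet) lt.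
by apply; exact: mem_blk.
Qed.

Lemma tau_blk_eq x y : blk (tau pi) x = blk (tau pi) y ->
  blk pi x = blk pi y /\ alpha x = alpha y.
Proof.
by case/blk_tau_eq => ->; rewrite ?(blk_pi_perm hpi) ?alpha_s.
Qed.

Lemma tau_blk_le x y : (blk (tau pi) x <= blk (tau pi) y)%N ->
  (blk pi x <= blk pi y)%N.
Proof.
rewrite leq_eqVlt => /orP[/eqP/tau_blk_eq[->] //|/tau_blk_lt/orP[/ltnW //|]].
by case/andP=> /eqP->.
Qed.

Lemma topset_tau (I : {set 'I_n}) : topset (tau pi) I -> topset pi I.
Proof.
move=> /topsetP tI; apply/topsetP => x xI y yI; apply: tau_blk_le; exact: tI.
Qed.

(* The [tau pi]-top sets are those that minimize the sum of the single weight
   [- K * blk pi x - alpha x], for [K] large. *)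
Lemma topset_alpha (I J : {set 'I_n}) :
  (0 < #|I|)%N -> #|I| = #|J| -> topset (tau pi) I -> topset pi J ->
  \sum_(x in J) alpha x <= \sum_(x in I) alpha x ?= iff topset (tau pi) J.
Proof.
(* [K] exceeds every difference of two values of [alpha], so one step in [blk pi] outweighs any
   change of [alpha]. *)
move=> I0 cIJ tI tJ; pose S : int := \sum_x `|alpha x|; pose K : int := 1 + (S + S).
have KP x y : alpha x - alpha y < K.
  have le z : `|alpha z| <= S.
    by rewrite /S (bigD1 z) //= lerDl sumr_ge0.
  have := le x; have := le y; have := ler_norm (alpha x); have := ler_norm (- alpha y).
  rewrite normrN /K; lia.
pose f x : int := - (K * (blk pi x)%:Z) - alpha x.
have f_lt x y : (blk (tau pi) x < blk (tau pi) y)%N -> f y < f x.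
  case/tau_blk_lt/orP=> [lt|/andP[/eqP e lt]]; last by rewrite /f e; lia.
  have : K <= K * ((blk pi y)%:Z - (blk pi x)%:Z).
    by apply: ler_peMr; [have := KP x x; lia|lia].
  have := KP x y; rewrite /f mulrBr; lia.
have fE x y : (f x <= f y) = (blk (tau pi) y <= blk (tau pi) x)%N.
  case: (ltngtP (blk (tau pi) y) (blk (tau pi) x)) => [/f_lt/ltW //|/f_lt lt|e].
    by apply/negbTE; rewrite -ltNge.
  by rewrite /f; have [-> ->] := tau_blk_eq e; rewrite lexx.
have gE x y : (- (blk pi x)%:Z <= - (blk pi y)%:Z) = (blk pi y <= blk pi x)%N.
  by rewrite lerN2 lez_nat.
(* Both sets are top for [pi], so their sums of [blk pi] agree and the terms in [K] cancel. *)
have [_ ] := topset_leif gE I0 cIJ (topset_tau tI).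
rewrite tJ !sumrN eqr_opp => /eqP eq_blk.
have := topset_leif fE I0 cIJ tI.
rewrite /f !sumrB !sumrN -!mulr_sumr eq_blk => -[le eq].
by split; [move: le; rewrite lerD2l lerN2|rewrite -eq (inj_eq (addrI _)) eqr_opp eq_sym].
Qed.

End Order.
End Tau.

(** * The torus action *)

Section Torus.
Variables (k : closedFieldType) (n : nat).

(** The diagonal matrix is a row scaling of the identity, seen as [mono id]; a nonzero minor of the
    identity forces the row set to be contained in the column set, hence equal to it. *)
Lemma extmx_diag i (e : 'I_n -> k) :
  extmx i (diag_mx (\row_x e x)) =
  diag_mx (\row_p \prod_(x in val (enum_val p : isubset n i)) e x).
Proof.
apply/matrixP => p q; rewrite mxE [RHS]mxE mxE.
have -> : diag_mx (\row_x e x) = \matrix_(x, y) (e x * mono id (fun=> 1) x y * 1).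
  apply/matrixP => x y; rewrite !mxE mulr1 eq_sym.
  by case: eqP => _; rewrite ?mulr1 ?mulr0.
rewrite det_minor_scale big1_eq mulr1; case: (p =P q) => [<-|ne].
  have -> : mxsub (isubset_nth (enum_val p)) (isubset_nth (enum_val p))
      (mono id (fun=> 1 : k)) = 1%:M.
    by apply/matrixP => u v; rewrite !mxE (inj_eq (@isubset_nth_inj _ _ _)) eq_sym; case: eqP.
  by rewrite det1 mulr1.
rewrite mulr0n; have [->|nz] := eqVneq (\det (mxsub (isubset_nth (enum_val p))
   (isubset_nth (enum_val q)) (mono id (fun=> 1 : k)))) 0; first by rewrite mulr0.
case: ne; apply/enum_val_inj/val_inj/eqP; rewrite eqEcard !card_isubset leqnn andbT.
by apply/subsetP => x; exact: minor_mono_mem nz.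
Qed.

Lemma act_diag (d : 'rV[k]_n) (x : lines k n) (i : 'I_n.-1) (Z : 'M[k]_(extdim n i.+1)) :
  (forall j, d 0 j != 0) -> x i = <[Z]>%VS ->
  act (diag_mx d) x i = <[\matrix_(p < extdim n i.+1, q < extdim n i.+1)
    (\prod_(j in val (enum_val p)) (d 0 j)^-1 * Z p q *
     \prod_(j in val (enum_val q)) (d 0 j)^-1)]>%VS.
Proof.
move=> d0 xE; rewrite /act xE limg_line lfunE /=.
have -> : invmx (diag_mx d) = diag_mx (\row_j (d 0 j)^-1).
  have e : diag_mx d *m diag_mx (\row_j (d 0 j)^-1) = 1%:M.
    apply/matrixP => u v; rewrite mul_diag_mx !mxE.
    by case: eqP => _; rewrite ?mulr0 // mulr1n divff.
  have [du _] := mulmx1_unit e.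
  by rewrite -[LHS]mulmx1 -e mulmxA mulVmx // mul1mx.
rewrite extmx_diag tr_diag_mx mul_diag_mx mul_mx_diag; congr <[_]>%VS.
by apply/matrixP => p q; rewrite !mxE.
Qed.

Hypothesis char0 : [pchar k] =i pred0.
Variables (mu : seq nat) (pi : seq (seq 'I_n)).
Hypotheses (hmu : is_composition n mu) (hpi : mu_involution mu pi).

Lemma inv_mx_tau : inv_mx k (tau pi) = inv_mx k pi.
Proof. by apply/matrixP => x y; rewrite !mxE /cycle_coef !(tau_perm hpi). Qed.

Lemma act_cq_point (d : 'rV[k]_n) i : (forall j, d 0 j != 0) ->
  act (diag_mx d) (cq_point (cq_of k pi)) i =
  <[scaled_top_minors pi (fun j => (d 0 j)^-1)%R (nat_of_ord i).+1]>%VS.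
Proof. by move=> d0; apply: act_diag => //; exact: cq_pointE hmu hpi _. Qed.

(** A nonzero coordinate is scaled by the product of [e x * e (s x)] over its row set. This factor
    is constant on the strings of [tau pi], so by [topset_prod] all top sets give the same
    scalar. *)
Lemma tau_torus_fixed : torus_fixed (cq_point (cq_of k (tau pi))).
Proof.
move=> d det1d i; have [mu' hmu' hpi'] := tau_involution hpi.
have d0 j : d 0 j != 0.
  apply/eqP => dj; have := det1d; rewrite det_diag (bigD1 j) //= dj mul0r => /eqP.
  by rewrite eq_sym oner_eq0.
rewrite (act_diag d0 (cq_pointE char0 hmu' hpi' i)) (cq_pointE char0 hmu' hpi').
have i_le : (i.+1 <= n)%N by have := ltn_ord i; lia.
have [I tI] := exists_topset (tau pi) i_le.
pose e x := (d 0 x)^-1; pose s := pi_perm (tau pi).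
have e0 x : e x != 0 by rewrite invr_eq0.
have sK : involutive s := pi_permK hpi'.
rewrite -[RHS](@vline_scale _ _ (\prod_(x in val I) (e x * e (s x)))); last first.
  by apply/prodf_neq0 => x _; rewrite mulf_neq0.
congr <[_]>%VS; apply/matrixP => p q; rewrite [LHS]mxE [RHS]mxE.
have [->|nz] := eqVneq (top_minors k (tau pi) i.+1 p q) 0; first by rewrite mulr0 mul0r mulr0.
rewrite mulrAC; congr (_ * _); move: nz; rewrite mxE.
case: ifP => [/andP[tp _]|_ /eqP //]; rewrite mxE => nz.
rewrite (big_minor_mono _ _ nz) -big_split /=.
apply: (topset_prod (f := fun x => e x * e (s x))) tp tI.
  by move=> x y /(blk_tau_eq hpi); rewrite -(tau_perm hpi) -/s => -[->|->] //; rewrite sK mulrC.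
by rewrite card_isubset (eqP (valP I)).
Qed.

(** * The limit under an admissible one-parameter subgroup *)

Section Limit.
Variable a : 'I_n -> int.
Hypothesis ha : admissible a.

(** The sign comes from the inverse matrix in the action on forms. *)
Let expo i (p q : 'I_(extdim n i)) : int :=
  - (\sum_(x in val (enum_val p)) a x + \sum_(y in val (enum_val q)) a y).

Lemma tau_exponent i : (0 < i <= n)%N -> exists m : int, forall p q : 'I_(extdim n i),
  (top_minors k pi i p q != 0 -> m <= expo p q) /\
  top_minors k (tau pi) i p q = if expo p q == m then top_minors k pi i p q else 0.
Proof.
case/andP=> i0 ile; have [I tI] := exists_topset (tau pi) ile.
have [mu' hmu' hpi'] := tau_involution hpi.
have cI : #|val I| = i by exact/eqP/(valP I).
pose alpha x := a x + a (pi_perm pi x).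
(* A top set of [tau pi] attains the largest sum of [alpha] among the top sets of [pi], hence the
   smallest exponent. *)
exists (- \sum_(x in val I) alpha x) => p q.
rewrite [top_minors _ pi _ _ _]mxE [top_minors _ (tau pi) _ _ _]mxE inv_mx_tau.
have [->|nz] := eqVneq (extmx i (inv_mx k pi) p q) 0; first by rewrite !if_same eqxx.
rewrite -(minor_top hpi nz).
have nzt : extmx i (inv_mx k (tau pi)) p q != 0 by rewrite inv_mx_tau.
rewrite -(minor_top hpi' nzt) !andbb.
case: ifP => [tp|ntp]; last first.
  by rewrite eqxx if_same ifN //; apply: contraFN ntp => /(topset_tau hpi ha).
have -> : expo p q = - \sum_(x in val (enum_val p)) alpha x.
  by rewrite /expo; move: nz; rewrite mxE => nz; rewrite (big_minor_mono _ a nz) -big_split.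
have [||le eq] := topset_alpha hpi ha _ _ tI tp; rewrite ?cI ?card_isubset //.
by rewrite lerN2 eqr_opp eq.
Qed.

Lemma tau_limit : limit_at0 (fun t : k => act (one_param a t) (cq_point (cq_of k pi)))
  (cq_point (cq_of k (tau pi))).
Proof.
have [mu' hmu' hpi'] := tau_involution hpi.
have sz (i : 'I_n.-1) : (0 < i.+1 <= n)%N by have := ltn_ord i; lia.
have [m mP] := fin_all_exists (fun i => tau_exponent (sz i)).
have d0 t : t != 0 -> forall j, (\row_j t ^ a j : 'rV[k]_n) 0 j != 0.
  by move=> t0 j; rewrite mxE expfz_neq0.
apply: limit_at0_ext (monomial_limit (phi := fun t : k => act (one_param a t) (cq_point (cq_of k pi)))
  (Z := fun i => top_minors k pi (nat_of_ord i).+1)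
  (Z0 := fun i => top_minors k (tau pi) (nat_of_ord i).+1)
  (e := fun i => @expo i.+1) (m := m) _ _ _ _ _) => //.
- by move=> i; rewrite (cq_pointE char0 hmu' hpi').
(* The translates lie in the variety as limits of rescaled nondegenerate quadrics. *)
- move=> t t0; have h := scaled_top_minors_complete char0 hpi
    (e := fun j => ((\row_j t ^ a j : 'rV[k]_n) 0 j)^-1) _.
  apply: zariski_closure_ext (h _) => [i|j]; last by rewrite invr_eq0 d0.
  by rewrite act_cq_point //; exact: d0.
- move=> t i t0; rewrite act_cq_point; last exact: d0.
  congr <[_]>%VS; apply/matrixP => p q; rewrite [LHS]mxE [RHS]mxE mulrAC; congr (_ * _).
  have prodE (I : {set 'I_n}) :
      \prod_(j in I) ((\row_j t ^ a j : 'rV[k]_n) 0 j)^-1 = t ^ (- \sum_(j in I) a j).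
    rewrite -sumrN (big_morph (fun z : int => t ^ z) (id1 := 1) (op1 := *%R)) //.
      by apply: eq_bigr => j _; rewrite mxE invr_expz.
    by move=> x y; rewrite expfzDr.
  by rewrite !prodE -expfzDr // /expo opprD.
- by move=> i p q; case: (mP i p q).
- by move=> i p q; case: (mP i p q).
move=> i; have [p [q nz]] := top_minors_neq0 char0 hpi' (proj2 (andP (sz i))).
by apply/matrix0Pn; exists p, q.
Qed.

End Limit.
End Torus.

Theorem proposition6p4 (k : closedFieldType) (char0 : [pchar k] =i pred0)
    (n : nat) (hn : (2 <= n)%N)
    (mu : seq nat) (hmu : is_composition n mu)
    (pi : seq (seq 'I_n)) (hpi : mu_involution mu pi)
    (a : 'I_n -> int) (ha : admissible a) :
  torus_fixed (cq_point (cq_of k (tau pi))) /\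
  limit_at0 (fun t : k => act (one_param a t) (cq_point (cq_of k pi)))
            (cq_point (cq_of k (tau pi))).
Proof.
split; first exact: tau_torus_fixed hpi.
exact: tau_limit hmu hpi a ha.
Qed.
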